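(* For any $r\in\mathbb{N}$ and $M>0$, there are positive constants $c_1,c_2,c_3,c_4$ such that the following holds. For any $d\in\mathbb{N}$ and $\varepsilon\in(0,1)$, there is a finite point set $P\subset[0,1]^d$ and a natural number $m$ such that the algorithm $A_{P,m}$ satisfies $\mathrm{e}(A_{P,m})\le\varepsilon$ and $$ \mathrm{cost}(A_{P,m})\le \begin{cases} c_1^d\,\varepsilon^{-1/r} & \text{if } M\in(0,\infty),\\ c_2\exp\left(c_3\,(1+\ln(\varepsilon^{-1}))(1+\ln d)\right) & \text{if } M\in(0,2^r r!),\\ c_4\,d^2\,\varepsilon^{-1/r}\ln(\varepsilon^{-1/r}) & \text{if } M\in(0,r!]. \end{cases} $$
   Context: For $r,d\in\mathbb{N}$ and $M>0$ let $$F_{r,M}^d=\Big\{\bigotimes_{i=1}^d f_i \;\Big|\; f_i:[0,1]\to[-1,1],\ f_i\in W_\infty^r([0,1]),\ \|f_i^{(r)}\|_\infty\le M\Big\},$$ where $\big(\bigotimes_{i=1}^d f_i\big)(x)=\prod_{i=1}^d f_i(x_i)$ for $x\in[0,1]^d$, $W_\infty^r([0,1])$ is the class of univariate functions having $r$ weak derivatives in $L_\infty([0,1])$ (identified with their continuous representatives), and $f_i^{(r)}$ is the $r$th weak derivative. $\|\cdot\|_\infty$ is the uniform norm, and $\ln$ is the natural logarithm. A deterministic algorithm $A$ obtains information on $f\in F_{r,M}^d$ through function values (at points that may be chosen adaptively) and outputs a function $A(f)$ on $[0,1]^d$. Its worst case error is $\mathrm{e}(A)=\sup_{f\in F_{r,M}^d}\|f-A(f)\|_\infty$.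 With $\mathrm{cost}(A,f)$ the number of function values used by $A$ for the input $f$, its worst case cost is $\mathrm{cost}(A)=\sup_{f\in F_{r,M}^d}\mathrm{cost}(A,f)$. Known ingredient (Bachmayr, Dahmen, DeVore, Grasedyck), which may be taken as given: there is a constant $C_{r,M}>0$ depending only on $r$ and $M$, and deterministic methods $I_m(z^*,\cdot)$, $m\in\mathbb{N}$, using $m$ function values, such that for every $\varepsilon\in(0,1)$ and $d\in\mathbb{N}$, with $m=\lfloor C_{r,M}\,d^{1+1/r}\varepsilon^{-1/r}\rfloor$, one has $\|I_m(z^*,f)-f\|_\infty\le\varepsilon$ for every $f\in F_{r,M}^d$ and every $z^*\in[0,1]^d$ with $f(z^* )\ne0$. Such a constant and such methods are fixed. Algorithm $A_{P,m}$: given $m\in\mathbb{N}$, a finite set $P\subset[0,1]^d$ and $f\in F_{r,M}^d$, check for the points $x\in P$ whether $f(x)\neq0$. If some $z^*\in P$ with $f(z^* )\ne0$ is found, return $A_{P,m}(f)=I_m(z^*,f)$; if $f$ vanishes on all of $P$, return the zero function.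
   Formalization: In the third bound ln(ε^{-1/r}) is replaced by max(1, ln(ε^{-1/r})), since the printed bound tends to 0 as ε→1, forcing P empty and the zero algorithm, whose error is 1 > ε for the constant function 1. *)

(* Defs.v *)
From HB Require Import structures.
From mathcomp Require Import all_boot all_order all_algebra.
From mathcomp Require Import finmap.
From mathcomp Require Import all_classical all_reals all_analysis.
Import Order.TTheory GRing.Theory Num.Theory.
Import numFieldNormedType.Exports.

Set Implicit Arguments.
Unset Strict Implicit.
Unset Printing Implicit Defensive.

Local Open Scope classical_set_scope.
Local Open Scope ring_scope.

Section Sobolev.
Context {R : realType}.
Implicit Types (f g phi : R -> R).

(* Univariate functions on [0,1] are represented by total functions R -> R of
   which only the values on [0,1] are ever used. *)

Definition test_function phi : Prop :=
  (forall n x, derivable (derive1n n phi) x 1) /\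
  closure [set x | phi x != 0] `<=` `]0, 1[.

Definition weak_derivative k f g : Prop :=
  forall phi, test_function phi ->
    \int[lebesgue_measure]_(x in `]0, 1[) (f x * derive1n k phi x) =
    (-1) ^+ k * \int[lebesgue_measure]_(x in `]0, 1[) (g x * phi x).

Definition Linfty_norm g : \bar R :=
  'N[lebesgue_measure]_+oo%E [EFin \o (g \_ `[0, 1])].

Definition Linfty g : Prop :=
  measurable_fun (`[0, 1] : set R) g /\ (Linfty_norm g < +oo)%E.

Definition Sobolev_infty r f : Prop :=
  forall k, (k <= r)%N -> exists2 g, weak_derivative k f g & Linfty g.

(* Continuity selects the continuous representative; the weak derivative is
   unique up to null sets, so the existential in the last clause is harmless. *)
Definition factor_class r (M : R) f : Prop :=
  [/\ {within `[0, 1], continuous f},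
      forall x, x \in `[0, 1] -> f x \in `[-1, 1],
      Sobolev_infty r f
    & exists g, [/\ weak_derivative r f g, Linfty g & (Linfty_norm g <= M%:E)%E]].

End Sobolev.

Definition cube (R : realType) d := {ffun 'I_d -> {i01 R}}.

Section Recovery.
Context {R : realType} {d : nat}.
Implicit Types (f g : cube R d -> R) (F : set (cube R d -> R)).

Definition tensor (fs : 'I_d -> R -> R) : cube R d -> R :=
  fun x => \prod_(i < d) fs i (x i)%:num.

Definition rank_one_class r (M : R) : set (cube R d -> R) :=
  [set f | exists2 fs, forall i, factor_class r M (fs i) & f = tensor fs].

Definition sup_norm f : \bar R := ereal_sup [set `|f x|%:E | x in [set: cube R d]].

(* A deterministic algorithm with adaptive function values: either stop with
   an output, or query a point of the cube and continue depending on the value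
   obtained there. *)
Inductive algorithm : Type :=
| Output of cube R d -> R
| Query of cube R d & (R -> algorithm).

Fixpoint run (A : algorithm) f : cube R d -> R :=
  match A with
  | Output g => g
  | Query x k => run (k (f x)) f
  end.

Fixpoint cost (A : algorithm) f : nat :=
  match A with
  | Output _ => 0
  | Query x k => (cost (k (f x)) f).+1
  end.

Definition worst_error F (A : algorithm) : \bar R :=
  ereal_sup [set sup_norm (f \- run A f) | f in F].

Definition worst_cost F (A : algorithm) : \bar R :=
  ereal_sup [set (cost A f)%:R%:E | f in F].

Fixpoint detect_then (I : cube R d -> algorithm) (s : seq (cube R d)) : algorithm :=
  match s with
  | [::] => Output (fun=> 0)
  | z :: s' => Query z (fun y => if y == 0 then detect_then I s' else I z)
  end.

(* The points of P are tested one after the other, in the order of the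
   canonical enumeration of P, until a nonzero value is found. *)
Definition A_alg (I : nat -> cube R d -> algorithm) (P : {fset cube R d})
    (m : nat) : algorithm :=
  detect_then (I m) (enum_fset P).

End Recovery.
Arguments rank_one_class {R} d r M.
Arguments algorithm : clear implicits.

(* The methods I d m z recover rank one tensors from m function values, once
   a point z at which the tensor does not vanish is known. *)
Definition recovery_from_nonzero {R : realType} r (M C : R)
    (I : forall d, nat -> cube R d -> algorithm R d) : Prop :=
  (forall d m z f, (0 < d)%N -> rank_one_class d r M f ->
     (cost (I d m z) f <= m)%N) /\
  (forall d (e : R), (0 < d)%N -> 0 < e < 1 ->
     let m := Num.truncn (C * d%:R `^ (1 + r%:R^-1) * e `^ (- r%:R^-1)) in
     forall z f, rank_one_class d r M f -> f z != 0 ->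
       (sup_norm (run (I d m z) f \- f)%R <= e%:E)%E).

(* Main.v *)
Require Import Defs.
From mathcomp Require Import all_boot all_order all_algebra all_field finmap.
From mathcomp Require Import interval_inference.
From mathcomp Require Import all_classical all_reals all_analysis.
From mathcomp Require Import measurable_realfun ess_sup_inf.
From mathcomp Require Import ring lra zify.
Import Order.TTheory GRing.Theory Num.Theory.
Import numFieldNormedType.Exports.

Set Implicit Arguments.
Unset Strict Implicit.
Unset Printing Implicit Defensive.

(* Let f be the tensor of f_1, ..., f_d with |f x| > e.  By Rolle's theorem
   applied to mollifications of f_i, r zeros z_j of f_i force
   |f_i t| <= M / r! * prod |t - z_j|.  Hence f_i has fewer than r zeros in any
   interval around x_i of length l_i, a constant times |f_i x_i|^(1/r), and
   prod l_i is at least c^d e^(1/r).  The point set has to meet the set f != 0: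

   - in general, a zero-free dyadic box of volume c^d e^(1/r) is met by a net of
     C^d e^(-1/r) points.  Its points are polynomials over GF(2^d), read off
     through their Taylor digits at d places; all boxes prescribe some leading
     digits and a part of the next digit of each coordinate, and the next digits
     depend affinely on the d top coefficients of the polynomial.  There are so
     few affine maps, whatever the shape of the box, that a small set of top
     coefficients, obtained greedily, serves all of them.
   - if M < 2^r r!, all but O(ln (1/e)) factors are so large that they have fewer
     than r zeros around 1/2; these coordinates are set to a common value t, and
     the net is used for the few remaining coordinates.
   - if M <= r!, the constant is 1, so the boxes have volume e^(1/r) and a fine
     grid offers only exp (O(d ln (d/e))) box-minus-zeros patterns, to which the
     greedy hitting set applies. *)

Local Open Scope ring_scope.

(** * Smooth functions and a bump *)

Section Smooth.
Local Open Scope classical_set_scope.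
Local Open Scope ring_scope.
Context {R : realType}.
Implicit Types (f g : R -> R) (p q : {poly R}).

Definition smooth f := forall n x, derivable (derive1n n f) x 1.

(** The recursion passes to [derive1 f], so that the sum and product rules apply by induction on the
    order for all functions at once. *)
Fixpoint smooth_upto n f : Prop :=
  (forall x, derivable f x 1) /\
  if n is m.+1 then smooth_upto m (derive1 f) else True.

Lemma smooth_uptoW n f : smooth_upto n f -> forall x, derivable f x 1.
Proof. case: n => [[df _]|n [df _]]; exact: df. Qed.

Lemma smooth_uptoP f : smooth f <-> forall n, smooth_upto n f.
Proof.
split=> [sf n|sf n].
  elim: n f sf => [|n IH] f sf; split; try exact: (sf 0%N).
    exact: I.
  by apply: IH => k x; rewrite -derive1Sn; exact: sf.
elim: n f sf => [|n IH] f sf x; first exact: smooth_uptoW (sf 0%N) x.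
by rewrite derive1Sn; apply: IH => k; have [_ H] := sf k.+1; exact: H.
Qed.

Lemma smooth_uptoS n f : smooth_upto n.+1 f -> smooth_upto n f.
Proof.
elim: n f => [|n IH] f [df sf]; split; try exact: df; first exact: I.
exact: IH sf.
Qed.

Lemma derive1D f g : (forall x, derivable f x 1) -> (forall x, derivable g x 1) ->
  derive1 (f \+ g) = derive1 f \+ derive1 g.
Proof.
move=> df dg; apply/funext => x; rewrite derive1E (deriveD (df x) (dg x)).
by rewrite -!derive1E.
Qed.

Lemma derive1M f g : (forall x, derivable f x 1) -> (forall x, derivable g x 1) ->
  derive1 (f \* g) = (f \* derive1 g) \+ (g \* derive1 f).
Proof.
move=> df dg; apply/funext => x; rewrite derive1E (deriveM (df x) (dg x)).
by rewrite -!derive1E.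
Qed.

Lemma smooth_uptoD n f g :
  smooth_upto n f -> smooth_upto n g -> smooth_upto n (f \+ g).
Proof.
elim: n f g => [|n IH] f g sf sg; split.
- move=> x; apply: derivableD; [exact: smooth_uptoW sf x|exact: smooth_uptoW sg x].
- exact: I.
- move=> x; apply: derivableD; [exact: smooth_uptoW sf x|exact: smooth_uptoW sg x].
rewrite (derive1D (smooth_uptoW sf) (smooth_uptoW sg)).
exact: IH sf.2 sg.2.
Qed.

Lemma smooth_uptoM n f g :
  smooth_upto n f -> smooth_upto n g -> smooth_upto n (f \* g).
Proof.
elim: n f g => [|n IH] f g sf sg; split.
- move=> x; apply: derivableM; [exact: smooth_uptoW sf x|exact: smooth_uptoW sg x].
- exact: I.
- move=> x; apply: derivableM; [exact: smooth_uptoW sf x|exact: smooth_uptoW sg x].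
rewrite (derive1M (smooth_uptoW sf) (smooth_uptoW sg)).
apply: smooth_uptoD; first exact: IH (smooth_uptoS sf) sg.2.
exact: IH (smooth_uptoS sg) sf.2.
Qed.

Lemma smoothM f g : smooth f -> smooth g -> smooth (f \* g).
Proof.
move=> /smooth_uptoP sf /smooth_uptoP sg; apply/smooth_uptoP => n.
exact: smooth_uptoM (sf n) (sg n).
Qed.

Lemma smooth_derive1 f : smooth f -> smooth (derive1 f).
Proof. by move=> sf n x; rewrite -derive1Sn; exact: sf. Qed.

Lemma smooth_derive1n k f : smooth f -> smooth (derive1n k f).
Proof. move=> sf; elim: k => [|k IH]; [exact: sf|exact: smooth_derive1 IH]. Qed.

Lemma derive1_affine f (a b x : R) : derivable f (a * x + b) 1 ->
  is_derive x 1 (fun y => f (a * y + b)) (a * derive1 f (a * x + b)).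
Proof.
move=> df; have df' : is_derive (a * x + b) 1 f (derive1 f (a * x + b)).
  by rewrite derive1E; exact: derivableP.
have da : is_derive x 1 (fun y => a * y + b) a.
  by apply: is_derive_eq; rewrite addr0 /GRing.scale /= mulr1 ?scaler0 ?addr0.
have := @is_derive1_comp _ f (fun y => a * y + b) x (derive1 f (a * x + b)) a df' da.
by move=> H; apply: is_derive_eq; rewrite mulrC.
Qed.

Lemma derive1n_affine k f (a b : R) : smooth f ->
  derive1n k (fun y => f (a * y + b)) =
  (fun y => a ^+ k * derive1n k f (a * y + b)).
Proof.
move=> sf; elim: k => [|k IH]; first by apply/funext => y; rewrite /= expr0 mul1r.
rewrite derive1nS IH; apply/funext => y.
rewrite derive1E (@deriveZ _ _ _ (fun y => derive1n k f (a * y + b))).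
  have -> := @derive_val _ _ _ _ _ _ _ (derive1_affine (sf k (a * y + b))).
  by rewrite -derive1nS /GRing.scale /= mulrA -exprSr.
by have [] := derive1_affine (sf k (a * y + b)).
Qed.

Lemma smooth_affine f (a b : R) : smooth f -> smooth (fun y => f (a * y + b)).
Proof.
move=> sf n x; rewrite derive1n_affine //.
apply: derivableZ; exact: (@ex_derive _ _ _ _ _ _ _ (derive1_affine (sf n _))).
Qed.

(** With [p] arbitrary the class is closed under differentiation: the derivative replaces p by (p -
    p') X^2. [flat 1] is the usual exp(-1/x) on the positive axis. *)
Definition flat p x := if 0 < x then p.[x^-1] * expR (- x^-1) else 0.

Lemma pow_le_expR n (y : R) : 0 < y -> y ^+ n <= n%:R ^+ n * expR y.
Proof.
move=> y0; case: n => [|n]; first by rewrite !expr0 mul1r -expR0 ler_expR ltW.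
have n0 : (0 : R) < n.+1%:R by [].
rewrite -[X in expR X](@divfK _ n.+1%:R) ?gt_eqF// expRM_natr -exprMn.
rewrite lerXn2r ?nnegrE ?mulr_ge0 ?expR_ge0 1?ltW//.
rewrite mulrC -ltr_pdivrMr//; apply: lt_le_trans (expR_ge1Dx _).
by rewrite ltrDr.
Qed.

Lemma horner_le_expR p : exists C, forall y : R, 0 < y -> `|p.[y]| <= C * expR y.
Proof.
exists (\sum_(i < size p) `|p`_i| * i%:R ^+ i) => y y0.
rewrite horner_coef mulr_suml; apply: le_trans (ler_norm_sum _ _ _) _.
apply: ler_sum => i _; rewrite normrM -mulrA ler_wpM2l//.
by rewrite normrX gtr0_norm// pow_le_expR.
Qed.

(** The exponential dominates p X^2 at 1/x as well, which leaves a factor x^2; this quadratic decay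
    makes the derivative at 0 vanish. *)
Lemma flat_le_sqr p : exists2 C, 0 <= C & forall x, `|flat p x| <= C * x ^+ 2.
Proof.
have [C HC] := horner_le_expR (p * 'X^2); exists `|C| => // x.
rewrite /flat; case: ifPn => [x0|_]; last by rewrite normr0 mulr_ge0 ?sqr_ge0.
have x1 : 0 < x^-1 by rewrite invr_gt0.
have := HC _ x1; rewrite hornerM hornerXn normrM [ `|_ ^+ 2|]gtr0_norm ?exprn_gt0//.
rewrite -ler_pdivlMr ?exprn_gt0// => H.
rewrite normrM [ `|expR _|]gtr0_norm ?expR_gt0// expRN -ler_pdivlMr ?invr_gt0 ?expR_gt0//.
rewrite invrK; apply: le_trans H _; rewrite -exprVn invrK mulrAC.
by rewrite ler_wpM2r ?expR_ge0// ler_wpM2r ?sqr_ge0// ler_norm.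
Qed.

Lemma is_derive_flat p (x : R) : is_derive x (1 : R) (flat p) (flat ((p - p^`()) * 'X^2) x).
Proof.
have [x0|x0|->] := ltgtP x 0; last first.
- have [C C0 HC] := flat_le_sqr p.
  have f0 q : flat q 0 = 0 by rewrite /flat ltxx.
  have quot (h : R) : h != 0 -> `|h^-1 * flat p h| <= C * `|h|.
    move=> h0; rewrite normrM normfV mulrC ler_pdivrMr ?normr_gt0//.
    by rewrite -mulrA -normrM -expr2 (ger0_norm (sqr_ge0 _)); exact: HC.
  have lim : h^-1 *: (flat p (h *: 1 + 0) - flat p 0) @[h --> (0 : R)^'] --> (0 : R).
    apply: norm_cvg0; apply: (@squeeze_cvgr _ _ _ _ (cst 0) (fun h => C * `|h|)).
    + near=> h; rewrite normr_ge0 /= f0 subr0 addr0 /GRing.scale /= mulr1.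
      by apply: quot; near: h; exact: nbhs_dnbhs_neq.
    + exact: cvg_cst.
    + rewrite -[X in _ --> X](mulr0 C); apply: cvgM; first exact: cvg_cst.
      rewrite -[X in _ --> X](@normr0 _ R); apply: cvg_norm; exact: cvg_within.
  rewrite f0; apply: DeriveDef; first by apply/cvg_ex; exists 0.
  exact/cvg_lim.
- have dV : is_derive x 1 (fun y : R => y^-1) (- x^-2).
    have x1 : id x != 0 by rewrite gt_eqF.
    have := @is_deriveV R id x 1 1 x1 (is_derive_id x 1).
    by rewrite /GRing.scale /= mulr1.
  have dp := @is_derive1_comp _ (horner p) (fun y : R => y^-1) x _ _ (is_derive_poly p x^-1) dV.
  have dN : is_derive x 1 (fun y : R => - y^-1) (x^-2).
    by apply: is_derive_eq; rewrite opprK.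
  have de := @is_derive1_comp _ (@expR R) (fun y : R => - y^-1) x _ _ (is_derive_expR (- x^-1)) dN.
  have dpe := is_deriveM dp de.
  have eqn : \near x, ((horner p \o (fun y : R => y^-1)) *
      (@expR R \o (fun y : R => - y^-1))) x = flat p x.
    near=> y; rewrite /flat ifT; first by [].
    by near: y; exact: lt_nbhsr.
  apply: is_derive_eq (near_eq_is_derive eqn dpe) _.
  rewrite /flat x0 hornerM hornerXn !hornerE /GRing.scale /=.
  rewrite /comp/=; field; exact: lt0r_neq0.
- rewrite [X in is_derive _ _ _ X]/flat ltNge (ltW x0) /=.
  apply: near_eq_is_derive (is_derive_cst 0 x 1).
  near=> y; rewrite /flat ifF//; apply/negbTE; rewrite -leNgt ltW//.
  by near: y; exact: lt_nbhsl.
Unshelve. all: by end_near. Qed.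

Lemma smooth_flat p : smooth (flat p).
Proof.
have dflat q : derive1 (flat q) = flat ((q - q^`()) * 'X^2).
  by apply/funext => x; rewrite derive1E; apply: derive_val; exact: is_derive_flat.
move=> n x; have [q ->] : exists q, derive1n n (flat p) = flat q.
  elim: n => [|n [q IH]]; first by exists p.
  by exists ((q - q^`()) * 'X^2); rewrite derive1nS IH dflat.
by have [] := is_derive_flat q x.
Qed.

(** A smooth bump, positive exactly on ]-h, h[. Its mass is not computed but divided out later. *)
Definition bumpf (h x : R) := flat 1 (x + h) * flat 1 (h - x).

Lemma smooth_bumpf h : smooth (bumpf h).
Proof.
have -> : bumpf h = (fun y => flat 1 (1 * y + h)) \* (fun y => flat 1 (-1 * y + h)).
  by apply/funext => x; rewrite /bumpf /= mul1r mulN1r (addrC h).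
by apply: smoothM; apply: smooth_affine; exact: smooth_flat.
Qed.

Lemma flat1_ge0 x : 0 <= flat 1 x.
Proof. by rewrite /flat; case: ifP => // _; rewrite hornerC mul1r expR_ge0. Qed.

Lemma flat1_gt0 x : (0 < flat 1 x) = (0 < x).
Proof.
by rewrite /flat; case: ifP => [_|]; rewrite ?ltxx// hornerC mul1r expR_gt0.
Qed.

Lemma bumpf_ge0 h x : 0 <= bumpf h x.
Proof. by rewrite mulr_ge0 ?flat1_ge0. Qed.

Lemma bumpf_gt0 h x : `|x| < h -> 0 < bumpf h x.
Proof.
by rewrite ltr_norml => /andP[h1 h2]; rewrite mulr_gt0 ?flat1_gt0; lra.
Qed.

Lemma bumpf_eq0 h x : h <= `|x| -> bumpf h x = 0.
Proof.
rewrite ler_normr => /orP[hx|hx]; apply/eqP; rewrite mulf_eq0.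
  by apply/orP; right; rewrite /flat ltNge subr_le0 hx.
by apply/orP; left; rewrite /flat ltNge (_ : x + h <= 0) //; lra.
Qed.

End Smooth.

(** * Mollification *)

Section Mollify.
Local Open Scope classical_set_scope.
Local Open Scope ring_scope.
Context {R : realType}.
Implicit Types (f g : R -> R).
Notation mu := (@lebesgue_measure R).

(** Integrating over ]0, 1[ only avoids extending [f]; this is the usual convolution as long as the
    support of g(x - .) stays inside ]0, 1[. *)
Definition mollify f g x : R := \int[mu]_(y in `]0, 1[) (f y * g (x - y)).

Lemma smooth_continuous f : smooth f -> continuous f.
Proof.
by move=> sf x; apply: differentiable_continuous; apply/derivable1_diffP; exact: (sf 0%N).
Qed.

Lemma smooth_bounded f (a b : R) : smooth f ->
  exists2 K, 0 <= K & forall x, x \in `[a, b] -> `|f x| <= K.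
Proof.
move=> sf; have cf : {within `[a, b], continuous (fun x => `|f x|)}.
  apply: continuous_subspaceT => x; apply: continuous_comp; last exact: norm_continuous.
  exact: smooth_continuous.
have [ab|ba] := leP a b; last first.
  by exists 0 => // x; rewrite in_itv /= => /andP[/le_trans/[apply]]; rewrite leNgt ba.
by have [c _ cP] := EVT_max ab cf; exists `|f c|.
Qed.

Lemma integrable01 f (B : R) : measurable_fun (`]0, 1[ : set R) f ->
  (forall x, x \in `]0, 1[ -> `|f x| <= B) ->
  mu.-integrable `]0, 1[ (EFin \o f).
Proof.
move=> mf fB; apply: measurable_bounded_integrable => //.
  by rewrite /= lebesgue_measure_itv /= lte_fin ltr01 -EFinD ltry.
exists B; split; first exact: num_real.
by move=> M BM x /= x01; rewrite (le_trans (fB _ x01))// ltW.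
Qed.

Section Convolution.
Variables (f : R -> R) (B : R).
Hypotheses (mf : measurable_fun (`]0, 1[ : set R) f)
  (fB : forall x, x \in `]0, 1[ -> `|f x| <= B).

Lemma measurable_mollify g (x : R) : smooth g ->
  measurable_fun (`]0, 1[ : set R) (fun y => f y * g (x - y)).
Proof.
move=> sg; apply: measurable_funM => //.
apply: measurable_funTS; apply: continuous_measurable_fun.
move=> y; apply: continuous_comp; last exact: smooth_continuous.
by apply: continuousB; [exact: cst_continuous|exact: cvg_id].
Qed.

Lemma integrable_mollify g (x : R) : smooth g ->
  mu.-integrable `]0, 1[ (EFin \o (fun y => f y * g (x - y))).
Proof.
move=> sg; have [K K0 gK] := smooth_bounded (x - 1) x sg.
apply: (@integrable01 _ (B * K)); first exact: measurable_mollify.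
move=> y y01; rewrite normrM ler_pM//; first exact: fB.
by apply: gK; move: y01; rewrite !in_itv /=; lra.
Qed.

Lemma mollify_deriv g (a : R) : smooth g ->
  derivable (mollify f g) a 1 /\ derive1 (mollify f g) a = mollify f (derive1 g) a.
Proof.
move=> sg; pose F (x y : R) := f y * g (x - y).
have dF (x y : R) : is_derive x 1 (F ^~ y) (f y * derive1 g (x - y)).
  rewrite (_ : F ^~ y = f y *: (fun x => g (1 * x + (- y)))); last first.
    by apply/funext => z; rewrite -[RHS]/(f y * g (1 * z - y)) mul1r.
  have H : derivable g (1 * x + - y) 1 by exact: (sg 0%N).
  have := is_deriveZ (f y) (derive1_affine H).
  by rewrite !mul1r.
have d1F (x y : R) : partial1of2 F x y = f y * derive1 g (x - y).
  by rewrite partial1of2E; apply: derive_val.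
(* For x within 1 of a and y in ]0, 1[, the difference x - y lies in ]a - 2, a + 1[; the constant
   [B * K] then dominates the integrand's derivative. *)
have [K K0 gK] := smooth_bounded (a - 2) (a + 1) (smooth_derive1 sg).
have aI : `]a - 1, a + 1[%classic a by rewrite /= in_itv /=; lra.
have m01 : measurable (`]0, 1[ : set R) by [].
have iF (x : R) : `]a - 1, a + 1[%classic x -> mu.-integrable `]0, 1[ (EFin \o F x).
  by move=> _; exact: integrable_mollify.
have dF1 (x y : R) : `]a - 1, a + 1[%classic x -> `]0, 1[%classic y -> derivable (F ^~ y) x 1.
  by move=> _ _; have [] := dF x y.
have B0 : 0 <= B by apply: le_trans (fB (x := 2^-1) _) => //; rewrite in_itv /=; lra.
have G0 : forall y : R, 0 <= cst (B * K) y by move=> y; rewrite mulr_ge0.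
have iG : mu.-integrable `]0, 1[ (EFin \o cst (B * K)).
  by apply: (@integrable01 _ (B * K)) => // x _; rewrite /= ger0_norm ?mulr_ge0.
have GF (x y : R) : `]a - 1, a + 1[%classic x -> `]0, 1[%classic y ->
    `|partial1of2 F x y| <= cst (B * K) y.
  move=> xI yI; rewrite d1F normrM ler_pM//; first exact: fB.
  by apply: gK; move: xI yI; rewrite /= !in_itv /=; lra.
split; first exact: (@derivable_under_integral R _ _ mu F _ m01 a _ _ aI iF dF1 _ G0 iG GF).
rewrite (@differentiation_under_integral R _ _ mu F _ m01 a _ _ aI iF dF1 _ G0 iG GF).
by apply: eq_Rintegral => y _; rewrite d1F.
Qed.

Lemma derive1n_mollify g k : smooth g -> derive1n k (mollify f g) = mollify f (derive1n k g).
Proof.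
move=> sg; elim: k => // k IH; rewrite derive1nS IH; apply/funext => x.
by have [_ ->] := mollify_deriv x (smooth_derive1n (k:=k) sg); rewrite -derive1nS.
Qed.

Lemma smooth_mollify g : smooth g -> smooth (mollify f g).
Proof.
move=> sg n x; rewrite derive1n_mollify//.
by have [] := mollify_deriv x (smooth_derive1n (k:=n) sg).
Qed.

End Convolution.
End Mollify.

(** * Smooth approximation with a bound on the r-th derivative *)

Section Approx.
Local Open Scope classical_set_scope.
Local Open Scope ring_scope.
Context {R : realType}.
Implicit Types (f g : R -> R).
Notation mu := (@lebesgue_measure R).

Lemma smooth_cst (k : R) : smooth (cst k).
Proof.
move=> n x; have [c ->] : exists c : R, derive1n n (cst k) = cst c.
  elim: n => [|n [c IH]]; first by exists k.
  by exists 0; rewrite derive1nS IH; apply/funext => y; rewrite derive1_cst.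
exact: derivable_cst.
Qed.

(** Truncating [g] to [-M, M] alters it on a null set only, which turns the essential bound into a
    pointwise one. *)
Lemma bounded_weak_derivative r (M : R) f g : 0 <= M ->
  weak_derivative r f g -> Linfty g -> (Linfty_norm g <= M%:E)%E ->
  exists g', [/\ weak_derivative r f g', measurable_fun (`]0, 1[ : set R) g'
    & forall x, `|g' x| <= M].
Proof.
move=> M0 wg [mg _] gM.
pose g' x := Num.max (- M) (Num.min M (g x)).
have mg01 : measurable_fun (`]0, 1[ : set R) g.
  apply: measurable_funS mg => //; exact: subset_itv_oo_cc.
have mg' : measurable_fun (`]0, 1[ : set R) g'.
  by apply: measurable_maxr => //; apply: measurable_minr.
exists g'; split=> //; last first.
  move=> x; rewrite ler_norml /g' le_max lexx /= ge_max ge_min lexx /= andbT.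
  lra.
move=> phi tphi; rewrite wg//; congr (_ * _); congr fine.
have mphi : measurable_fun (`]0, 1[ : set R) phi.
  by apply: measurable_funTS; apply: continuous_measurable_fun;
    apply: smooth_continuous; case: tphi.
apply: ae_eq_integral => //.
- by apply/measurable_EFinP; apply: measurable_funM.
- by apply/measurable_EFinP; apply: measurable_funM.
move: gM; rewrite /Linfty_norm unlock /Lnorm ifT; last first.
  by rewrite -(@set_itvNyy _ R) /= lebesgue_measure_itv /= ltry.
move/ess_supP; apply: filterS => x /= gx x01; congr (_ * _)%:E.
move: gx; rewrite patchE mem_set; last exact: subset_itv_oo_cc x01.
rewrite /= lee_fin ler_norml => /andP[g1 g2].
by rewrite /g' (min_idPr g2) (max_idPr g1).
Qed.

Lemma uniform_radius f (s : seq R) (d : R) : 0 < d ->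
  {within `[0, 1], continuous f} -> (forall x, x \in s -> x \in `]0, 1[) ->
  exists h, [/\ 0 < h, h < 2^-1, forall x, x \in s -> h < x < 1 - h &
    forall x y, x \in s -> `|x - y| < h -> `|f y - f x| <= d].
Proof.
move=> d0 /(continuous_within_itvP _ ltr01)[cf _ _].
elim: s => [|x s IH] s01; first by exists 4^-1; split=> //; lra.
have [h1 [h10 h12 H01 H1]] := IH (fun y ys => s01 y (mem_behead (s := x :: s) ys)).
have x01 := s01 x (mem_head _ _).
have /cvgrPdist_le/(_ d d0)[h2 /= h20 H2] := cf x x01.
move: x01; rewrite in_itv /= => /andP[x0 x1].
pose h := Num.min (Num.min h1 h2) (Num.min (x / 2) ((1 - x) / 2)).
have hh1 : h <= h1 by rewrite !ge_min lexx.
have hh2 : h <= h2 by rewrite !ge_min lexx orbT.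
have hx1 : h <= x / 2 by rewrite !ge_min lexx !orbT.
have hx2 : h <= (1 - x) / 2 by rewrite !ge_min lexx !orbT.
have h0 : 0 < h by rewrite !lt_min h10 h20 /=; lra.
exists h; split=> //; first lra.
  by move=> z; rewrite inE => /orP[/eqP->|/H01]; lra.
move=> z y; rewrite inE => /orP[/eqP->|zs] zy.
  by rewrite distrC; apply: H2; exact: lt_le_trans zy hh2.
by apply: H1 => //; exact: lt_le_trans zy hh1.
Qed.

Definition bump_mass (h : R) := mollify (cst 1) (bumpf h).

Lemma measurable_cst1 : measurable_fun (`]0, 1[ : set R) (cst 1 : R -> R).
Proof. exact: measurable_cst. Qed.

Lemma cst1_le1 : forall x : R, x \in `]0, 1[ -> `|(cst 1 : R -> R) x| <= 1.
Proof. by move=> x _; rewrite /= normr1. Qed.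

(** By compactness the bump has a positive minimum on [x - h/2, x + h/2], an interval inside ]0,
    1[. *)
Lemma bump_mass_gt0 (h x : R) : 0 < h -> h < x < 1 - h -> 0 < bump_mass h x.
Proof.
move=> h0 xab; have h2 : 0 < h / 2 by lra.
have xh (y : R) : y \in `[x - h/2, x + h/2] -> `|x - y| < h.
  by rewrite in_itv /= => /andP[y1 y2]; rewrite ltr_norml; lra.
have [||c cI cmin] := @EVT_min _ (fun y => bumpf h (x - y)) (x - h/2) (x + h/2).
- lra.
- apply: continuous_subspaceT => y; apply: (@continuous_comp _ _ _ (fun y : R => x - y) (bumpf h)).
    by apply: continuousB; [exact: cst_continuous|exact: cvg_id].
  by apply: smooth_continuous; exact: smooth_bumpf.
have c0 : 0 < bumpf h (x - c) by apply: bumpf_gt0; exact: xh.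
have iconv := integrable_mollify measurable_cst1 cst1_le1 x (@smooth_bumpf _ h).
have sub : [set` `[x - h/2, x + h/2] ] `<=` (`]0, 1[ : set R).
  by move=> y /=; rewrite !in_itv /=; lra.
apply: (@lt_le_trans _ _ (\int[mu]_(y in `[x - h/2, x + h/2]) bumpf h (x - c))).
  rewrite Rintegral_cst//= lebesgue_measure_itv /= lte_fin ifT; last lra.
  by rewrite -EFinB /= mulr_gt0//; lra.
apply: (@le_trans _ _ (\int[mu]_(y in `[x - h/2, x + h/2]) (cst 1 y * bumpf h (x - y)))).
  apply: le_Rintegral => //.
  - apply: (@integrableS _ _ R mu _ _ _ _ _ sub) => //.
    by apply: (@integrable01 _ _ `|bumpf h (x - c)|).
  - by apply: (@integrableS _ _ R mu _ _ _ _ _ sub).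
  - by move=> y yI; rewrite /= mul1r; exact: cmin.
rewrite /bump_mass /mollify; apply: fine_le.
- by apply: integrable_fin_num => //; apply: (@integrableS _ _ R mu _ _ _ _ _ sub).
- exact: integrable_fin_num.
apply: ge0_subset_integral => //.
  by have /integrableP[] := iconv.
by move=> y _; rewrite lee_fin mul1r bumpf_ge0.
Qed.

(* The bump has constant mass as long as it does not touch the boundary:
   the derivative of the mass is the integral of a derivative. *)
Lemma bump_mass_const (h x y : R) : 0 < h -> h < x < 1 - h -> h < y < 1 - h ->
  bump_mass h x = bump_mass h y.
Proof.
move=> h0; wlog xy : x y / x <= y => [H hx hy|].
  have [xy|/ltW yx] := leP x y; first exact: H xy hx hy.
  exact: esym (H _ _ yx hy hx).
move=> hx hy.
have D (z : R) : derivable (bump_mass h) z 1 /\ derive1 (bump_mass h) z =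
    mollify (cst 1) (derive1 (bumpf h)) z.
  exact: (mollify_deriv measurable_cst1 cst1_le1 z (@smooth_bumpf _ h)).
have D0 (z : R) : h < z < 1 - h -> is_derive z 1 (bump_mass h) 0.
  move=> hz; apply: DeriveDef; first by have [] := D z.
  rewrite -derive1E; have [_ ->] := D z; rewrite /mollify.
  have db : forall y : R, is_derive y 1 (fun y => - bumpf h (z - y)) (derive1 (bumpf h) (z - y)).
    move=> u; have sb : derivable (bumpf h) (-1 * u + z) 1 by exact: (@smooth_bumpf _ h 0%N _).
    have H := is_deriveN (derive1_affine sb).
    rewrite (_ : (fun y => _) = - (fun y => bumpf h (-1 * y + z))); last first.
      by apply/funext => v; rewrite fctE mulN1r addrC.
    by apply: is_derive_eq H _; rewrite !mulN1r opprK addrC.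
  transitivity (\int[mu]_(u in `]0, 1[) derive1 (bumpf h) (z - u)).
    by apply: eq_Rintegral => u _; rewrite mul1r.
  have cd : continuous (fun u : R => derive1 (bumpf h) (z - u)).
    move=> u; apply: (@continuous_comp _ _ _ (fun y : R => z - y) (derive1 (bumpf h))).
      by apply: continuousB; [exact: cst_continuous|exact: cvg_id].
    by apply: smooth_continuous; apply: smooth_derive1; exact: smooth_bumpf.
  have cF : continuous (fun u : R => - bumpf h (z - u)).
    move=> u; apply: differentiable_continuous; apply/derivable1_diffP.
    by have [] := db u.
  have icd : mu.-integrable `[0, 1] (EFin \o (fun u : R => derive1 (bumpf h) (z - u))).
    by apply: continuous_compact_integrable; [exact: segment_compact|exact: continuous_subspaceT].
  rewrite Rintegral_itv_obnd_cbnd; last first.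
    apply: (@integrableS _ _ R mu _ _ _ _ _ _ icd) => //; exact: subset_itv_oo_cc.
  rewrite Rintegral_itv_bndo_bndc; last first.
    apply: (@integrableS _ _ R mu _ _ _ _ _ _ icd) => //; exact: subset_itv_co_cc.
  rewrite /Rintegral (@continuous_FTC2 _ _ (fun y : R => - bumpf h (z - y)))//.
  - have -> : bumpf h (z - 1) = 0.
      by apply: bumpf_eq0; rewrite ler_normr; apply/orP; right; lra.
    have -> : bumpf h (z - 0) = 0.
      by apply: bumpf_eq0; rewrite ler_normr; apply/orP; left; lra.
    by rewrite -EFinB /= subrr.
  - by apply: continuous_subspaceT.
  - split.
    + by move=> u _; have [] := db u.
    + by apply: cvg_at_right_filter; exact: cF.
    + by apply: cvg_at_left_filter; exact: cF.
  - by move=> u _; rewrite derive1E; apply: derive_val.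
have [||c _] := @MVT_segment _ (bump_mass h) (cst 0) x y xy.
- by move=> z; rewrite in_itv /= => zxy; apply: D0; lra.
- apply: continuous_subspaceT => z; apply: differentiable_continuous.
  by apply/derivable1_diffP; have [] := D z.
rewrite /= mul0r => /subr0_eq E; exact: esym E.
Qed.

(** Makes the mollifying kernel admissible in the definition of the weak derivative: its support
    lies in [x - h, x + h], inside ]0, 1[. *)
Lemma test_function_reflect g (h x : R) : 0 < h -> h < x < 1 - h -> smooth g ->
  (forall y, h <= `|y| -> g y = 0) -> test_function (fun y => g (x - y)).
Proof.
move=> h0 hx sg g0; have E : (fun y => g (x - y)) = (fun y => g (-1 * y + x)).
  by apply/funext => y; rewrite mulN1r addrC.
split; first by rewrite E; exact: smooth_affine.
apply: (@subset_trans _ `[x - h, x + h]); last first.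
  by move=> y /=; rewrite !in_itv /=; lra.
have /closure_id -> : closed (`[x - h, x + h] : set R) by exact: interval_closed.
apply: closure_subset => y /= gy; rewrite in_itv /= -ler_distlC.
rewrite leNgt; apply: contra gy => /ltW xy; rewrite g0 //.
Qed.

(** Mollification with a normalised bump. Where the kernel stays inside ]0, 1[, the r-th derivative
    is an average of the weak derivative, hence at most M. Continuity at the finitely many points of
    [s] keeps the values there within d. *)
Lemma smooth_approx r (M : R) f (s : seq R) (d : R) : 0 <= M -> 0 < d ->
  factor_class r M f -> (forall x, x \in s -> x \in `]0, 1[) ->
  exists F h, [/\ smooth F, forall x, x \in s -> `|F x - f x| <= d,
    forall x, x \in s -> h < x < 1 - h &
    forall x, h < x < 1 - h -> `|derive1n r F x| <= M].
Proof.
move=> M0 d0 [cf f1 _ [g0 [wg Lg gM]]] s01.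
have [g [{}wg mg {}gM]] := bounded_weak_derivative M0 wg Lg gM.
have mf : measurable_fun (`]0, 1[ : set R) f.
  apply: measurable_funS (subspace_continuous_measurable_fun _ cf) => //.
  exact: subset_itv_oo_cc.
have {}f1 x : x \in `]0, 1[ -> `|f x| <= 1.
  move=> x01; have := f1 x (subset_itv_oo_cc x01).
  by rewrite in_itv /= ler_norml.
have gB : forall x, x \in `]0, 1[ -> `|g x| <= M by move=> x _.
have [h [h0 h2 hs fh]] := uniform_radius d0 cf s01.
pose c := bump_mass h 2^-1.
have hh : h < 2^-1 < 1 - h by lra.
have c0 : 0 < c by exact: bump_mass_gt0.
have cE x : h < x < 1 - h -> \int[mu]_(y in `]0, 1[) bumpf h (x - y) = c.
  move=> hx; rewrite /c -(bump_mass_const h0 hx hh).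
  by apply: eq_Rintegral => y _; rewrite /= mul1r.
pose psi := (cst c^-1 : R -> R) \* bumpf h.
have spsi : smooth psi by apply: smoothM; [exact: smooth_cst|exact: smooth_bumpf].
have psi0 y : 0 <= psi y by rewrite mulr_ge0 ?bumpf_ge0// invr_ge0 ltW.
have psi_eq0 y : h <= `|y| -> psi y = 0 by move=> hy; rewrite /psi /= bumpf_eq0 ?mulr0.
have ipsi x : mu.-integrable `]0, 1[ (EFin \o (fun y : R => psi (x - y))).
  have := integrable_mollify measurable_cst1 cst1_le1 x spsi.
  by apply: eq_integrable => // y _ /=; rewrite mul1r.
have ibump x : mu.-integrable `]0, 1[ (EFin \o (fun y : R => bumpf h (x - y))).
  have := integrable_mollify measurable_cst1 cst1_le1 x (@smooth_bumpf _ h).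
  by apply: eq_integrable => // y _ /=; rewrite mul1r.
have psi1 x : h < x < 1 - h -> \int[mu]_(y in `]0, 1[) psi (x - y) = 1.
  by move=> hx; rewrite /psi /= RintegralZl// cE// mulVf ?gt_eqF.
exists (mollify f psi), h; split; last 2 first.
- exact: hs.
- move=> x hx; rewrite (derive1n_mollify mf f1)//.
  have tphi := test_function_reflect h0 hx spsi psi_eq0.
  have E : (fun y => psi (x - y)) = (fun y => psi (-1 * y + x)).
    by apply/funext => y; rewrite mulN1r addrC.
  have ifr := integrable_mollify mf f1 x (smooth_derive1n (k := r) spsi).
  (* The r-th derivative of y -> psi(x - y) carries a sign (-1)^r, which cancels the one in the weak
     derivative. *)
  have -> : mollify f (derive1n r psi) x = \int[mu]_(y in `]0, 1[) (g y * psi (x - y)).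
    have := wg _ tphi; rewrite E derive1n_affine//.
    have -> : \int[mu]_(y in `]0, 1[) (f y * ((-1) ^+ r * derive1n r psi (-1 * y + x))) =
       (-1) ^+ r * mollify f (derive1n r psi) x.
      rewrite -RintegralZl//; apply: eq_Rintegral => y _.
      by rewrite mulrCA mulN1r (addrC (- y)).
    by apply: mulfI; rewrite signr_eq0.
  have ig := integrable_mollify mg gB x spsi.
  apply: le_trans (le_normr_Rintegral _ ig) _ => //.
  have -> : M = \int[mu]_(y in `]0, 1[) (M * psi (x - y)) by rewrite RintegralZl// psi1// mulr1.
  apply: le_Rintegral => //.
  + have /(integrable_norm) := ig; by apply: eq_integrable => // y _ /=.
  + by apply: (integrable_mollify (f := cst M) (B := `|M|)).
  by move=> y _; rewrite normrM (ger0_norm (psi0 _)) ler_wpM2r.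
- exact: (smooth_mollify mf f1).
- move=> x xs; have hx := hs x xs.
  have -> : f x = \int[mu]_(y in `]0, 1[) (f x * psi (x - y)).
    by rewrite RintegralZl// psi1// mulr1.
  have ifx : mu.-integrable `]0, 1[ (EFin \o (fun y : R => f x * psi (x - y))).
    by apply: (integrable_mollify (f := cst (f x)) (B := `|f x|)).
  have ifp := integrable_mollify mf f1 x spsi.
  rewrite /mollify -RintegralB//.
  have iB : mu.-integrable `]0, 1[ (EFin \o (fun y : R => f y * psi (x - y) - f x * psi (x - y))).
    by have := @integrableB _ _ R mu _ _ _ _ ifp ifx; apply; exact: measurable_itv.
  apply: le_trans (le_normr_Rintegral _ iB) _ => //.
  have -> : d = \int[mu]_(y in `]0, 1[) (d * psi (x - y)) by rewrite RintegralZl// psi1// mulr1.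
  apply: le_Rintegral => //.
  + have /(integrable_norm) := iB; by apply: eq_integrable => // y _ /=.
  + by apply: (integrable_mollify (f := cst d) (B := `|d|)).
  move=> y _; rewrite -mulrBl normrM (ger0_norm (psi0 _)).
  have [xy|xy] := ltP `|x - y| h; last by rewrite psi_eq0// !mulr0.
  by rewrite ler_wpM2r// fh.
Qed.

End Approx.

(** * Zeros of functions with a bounded weak derivative *)

Section Zeros.
Local Open Scope classical_set_scope.
Local Open Scope ring_scope.
Context {R : realType}.
Implicit Types (f g G : R -> R) (p : {poly R}).

Lemma derive1nB n f g : smooth f -> smooth g ->
  derive1n n (f \- g) = derive1n n f \- derive1n n g.
Proof.
elim: n f g => // n IH f g sf sg; rewrite !derive1Sn -IH; try exact: smooth_derive1.
congr derive1n; apply/funext => x.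
by rewrite derive1E deriveB -?derive1E//; [exact: (sf 0%N)|exact: (sg 0%N)].
Qed.

Lemma smoothB f g : smooth f -> smooth g -> smooth (f \- g).
Proof. by move=> sf sg n x; rewrite derive1nB//; exact: derivableB. Qed.

Lemma derive1n_horner n p : derive1n n (horner p) = horner (p^`(n))%R.
Proof. by elim: n => [|n IH]; rewrite ?derive1nS ?IH ?derivnS ?derivE// derivn0. Qed.

Lemma smooth_horner p : smooth (horner p).
Proof. by move=> n x; rewrite derive1n_horner; exact: derivable_horner. Qed.

(** One zero of the derivative in each gap; the bounds x and b are carried along so that the step
    can be iterated. *)
Lemma rolle_zeros G (x b : R) (s : seq R) : smooth G -> path <%R x s ->
  (forall y, y \in x :: s -> G y = 0 /\ y < b) ->
  exists t, [/\ size t = size s, sorted <%R t &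
    forall y, y \in t -> [/\ derive1 G y = 0, x < y & y < b]].
Proof.
move=> sG; elim: s x => [|y s IH] x; first by exists [::].
move=> /= /andP[xy ys] H.
have [t [st so tP]] := IH y ys (fun z zs => H z (mem_behead (s := x :: y :: s) zs)).
have [Gx xb] := H x (mem_head _ _).
have [|Gy yb] := H y; first by rewrite !inE eqxx orbT.
have [|||c cxy dc] := @Rolle _ G x y xy.
- by move=> z _; exact: (sG 0%N).
- by apply: continuous_subspaceT; exact: smooth_continuous.
- by rewrite Gx Gy.
move: cxy; rewrite in_itv /= => /andP[xc cy].
exists (c :: t); split; first by rewrite /= st.
  rewrite /= path_sortedE; last by move=> ? ? ?; exact: lt_trans.
  rewrite so andbT; apply/allP => z /tP[_ yz _]; exact: lt_trans yz.
move=> z; rewrite inE => /orP[/eqP->|/tP[? yz ?]].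
  by rewrite derive1E; split=> //; [exact: derive_val|exact: lt_trans yb].
by split=> //; exact: lt_trans yz.
Qed.

Lemma rolle_iter n G (a b : R) (s : seq R) : smooth G -> sorted <%R s ->
  size s = n.+1 -> (forall y, y \in s -> [/\ G y = 0, a < y & y < b]) ->
  exists c, [/\ derive1n n G c = 0, a < c & c < b].
Proof.
elim: n G s => [|n IH] G [//|x s] sG so [ss] sP.
  by exists x; apply: sP; rewrite mem_head.
have [|t [st tso tP]] := @rolle_zeros G x b s sG so.
  by move=> y /sP[].
have [|c cP] := IH _ _ (smooth_derive1 sG) tso (etrans st ss).
  move=> y /tP[Gy xy yb]; split=> //; apply: lt_trans xy.
  by have [] := sP x (mem_head _ _).
by exists c; rewrite derive1Sn.
Qed.

Lemma derivn_top n p (x : R) : (size p <= n.+1)%N ->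
  (p^`(n))%R.[x] = p`_n *+ n`!.
Proof.
move=> sp; have -> : (p^`(n))%R = (p`_n *+ n`!)%:P.
  apply/polyP => i; rewrite coef_derivn coefC; case: i => [|i] /=.
    by rewrite addn0 ffactnn.
  by rewrite nth_default ?mul0rn// (leq_trans sp)// addnS ltnS leq_addr.
by rewrite hornerC.
Qed.

(** The Lagrange basis polynomial of the node [y] among the nodes [z]. *)
Definition lagrange_at (z : seq R) (y : R) : {poly R} :=
  (\prod_(w <- rem y z) (y - w))^-1 *: \prod_(w <- rem y z) ('X - w%:P).

Lemma lagrange_atE z (y w : R) : uniq z -> y \in z -> w \in z ->
  (lagrange_at z y).[w] = (w == y)%:R.
Proof.
move=> uz yz wz; rewrite hornerZ; have [->|wy] := eqVneq w y.
  rewrite horner_prod (eq_bigr _ (fun w _ => hornerXsubC w y)).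
  rewrite mulVf// prodf_seq_neq0; apply/allP => v /=.
  by rewrite mem_rem_uniq// inE subr_eq0 eq_sym => /andP[].
have /rootP -> : root (\prod_(w <- rem y z) ('X - w%:P)) w.
  by rewrite root_prod_XsubC mem_rem_uniq// inE wy wz.
by rewrite mulr0.
Qed.

Lemma size_lagrange_at z (y : R) : y \in z -> (size (lagrange_at z y) <= size z)%N.
Proof.
move=> yz; apply: leq_trans (size_scale_leq _ _) _.
rewrite size_prod_XsubC size_rem// prednK//; by case: z yz.
Qed.

(* Interpolate F at the nodes z by a polynomial of degree < r, and apply Rolle
   to F minus the interpolant minus a multiple of prod (X - z_j). *)
Lemma interpolation_error r (N : R) F (a b x : R) (z : seq R) : smooth F ->
  uniq z -> size z = r -> x \notin z ->
  (forall y, y \in x :: z -> a < y < b) ->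
  (forall y, a < y < b -> `|derive1n r F y| <= N) ->
  `|F x - \sum_(y <- z) F y * (lagrange_at z y).[x]| <=
    N / r`!%:R * \prod_(y <- z) `|x - y|.
Proof.
move=> sF uz sz xz zab FN.
pose q := \sum_(y <- z) F y *: lagrange_at z y.
pose P := \prod_(y <- z) ('X - y%:P).
have qE w : q.[w] = \sum_(y <- z) F y * (lagrange_at z y).[w].
  by rewrite /q horner_sum; apply: eq_bigr => y _; rewrite hornerZ.
rewrite -qE.
have Px : P.[x] = \prod_(y <- z) (x - y).
  by rewrite horner_prod; apply: eq_bigr => y _; rewrite hornerXsubC.
have Px0 : P.[x] != 0 by rewrite -rootE root_prod_XsubC.
(* Chosen so that [T] agrees with [F] at x in addition to the nodes. *)
pose lam := (F x - q.[x]) / P.[x].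
pose T := q + lam *: P.
have sT : (size T <= r.+1)%N.
  apply: leq_trans (size_polyD _ _) _; rewrite geq_max; apply/andP; split.
    apply: (leq_trans (size_sum _ _ _)); apply/bigmax_leqP_seq => y yz _.
    by rewrite (leq_trans (size_scale_leq _ _))// leqW// -sz size_lagrange_at.
  by rewrite (leq_trans (size_scale_leq _ _))// size_prod_XsubC sz.
have Tr : T`_r = lam.
  rewrite coefD coefZ nth_default ?add0r; last first.
    apply: (leq_trans (size_sum _ _ _)); apply/bigmax_leqP_seq => y yz _.
    by rewrite (leq_trans (size_scale_leq _ _))// -sz size_lagrange_at.
  have := monic_prod_XsubC z predT id; rewrite monicE lead_coefE -/P.
  by rewrite size_prod_XsubC sz /= => /eqP ->; rewrite mulr1.
pose G := F \- horner T.
have sG : smooth G by apply: smoothB; [exact: sF|exact: smooth_horner].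
pose s := sort <=%R (x :: z).
have us : uniq (x :: z) by rewrite /= xz.
have [||y|c [Gc ac cb]] := @rolle_iter r G a b s sG.
- by rewrite sort_lt_sorted.
- by rewrite size_sort /= sz.
- rewrite mem_sort => yxz; have /andP[? ?] := zab y yxz; split=> //.
  move: yxz; rewrite inE /G /= hornerD hornerZ => /orP[/eqP->|yz].
    by rewrite divfK// addrCA subrr addr0 subrr.
  have /rootP -> : root P y by rewrite root_prod_XsubC.
  rewrite mulr0 addr0 qE (bigD1_seq y)//= lagrange_atE// eqxx mulr1.
  rewrite big_seq_cond big1 ?addr0 ?subrr// => w /andP[wz wy].
  by rewrite lagrange_atE// eq_sym (negbTE wy) mulr0.
move: Gc; rewrite (@derive1nB r F (horner T) sF (@smooth_horner T)).
rewrite /= derive1n_horner derivn_top// Tr => /eqP; rewrite subr_eq0 => /eqP Gc.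
have := FN c; rewrite ac cb Gc => /(_ isT); rewrite -(mulr_natr lam) normrM.
rewrite [ `|_%:R|]ger0_norm// -ler_pdivlMr ?ltr0n ?fact_gt0// => lamN.
have -> : F x - q.[x] = lam * P.[x] by rewrite divfK.
rewrite normrM Px normr_prod ler_wpM2r// prodr_ge0//.
Qed.

(** The interpolation estimate is applied to a smooth F that is d-close to f at x and at the nodes.
    As f vanishes at the nodes, the interpolant of F is at most d L at x, where L is the Lebesgue
    function of the nodes at x; d is arbitrarily small. *)
Lemma zeros_bound r (M : R) f (z : seq R) (x : R) : 0 <= M ->
  factor_class r M f -> uniq z -> size z = r ->
  (forall y, y \in z -> (y \in `]0, 1[) /\ f y = 0) -> x \in `]0, 1[ ->
  `|f x| <= M / r`!%:R * \prod_(y <- z) `|x - y|.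
Proof.
move=> M0 ff uz sz zP x01.
have B0 : 0 <= M / r`!%:R * \prod_(y <- z) `|x - y|.
  by rewrite mulr_ge0 ?divr_ge0// prodr_ge0.
have [xz|xz] := boolP (x \in z); first by have [_ ->] := zP x xz; rewrite normr0.
pose L := \sum_(y <- z) `|(lagrange_at z y).[x]|.
have L0 : 0 <= L by rewrite sumr_ge0.
apply/ler_addgt0Pr => e e0.
(* This makes the total error d + d L equal to e. *)
pose d := e / (1 + L).
have d0 : 0 < d by rewrite divr_gt0// ltr_wpDr.
have s01 y : y \in x :: z -> y \in `]0, 1[ by rewrite inE => /orP[/eqP->//|/zP[]].
have [F [h [sF Ff hs FM]]] := smooth_approx M0 d0 ff s01.
have E := interpolation_error sF uz sz xz hs FM.
have q0 : `|\sum_(y <- z) F y * (lagrange_at z y).[x]| <= d * L.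
  apply: le_trans (ler_norm_sum _ _ _) _; rewrite /L mulr_sumr.
  rewrite big_seq [leRHS]big_seq; apply: ler_sum => y yz.
  rewrite normrM ler_wpM2r//; have := Ff y; rewrite inE yz orbT => /(_ isT).
  by have [_ ->] := zP y yz; rewrite subr0.
have Fx : `|F x - f x| <= d by apply: Ff; rewrite mem_head.
have de : e = d + d * L by rewrite -[X in X + _]mulr1 -mulrDr divfK// gt_eqF// ltr_wpDr.
rewrite de; move: E q0 Fx; set q := \sum_(y <- z) _; set A := _ * _.
rewrite !ler_norml; lra.
Qed.

(** Both sides are continuous in x, so the estimate passes to the endpoints 0 and 1. *)
Lemma zeros_bound_closed r (M : R) f (z : seq R) (x : R) : 0 <= M ->
  factor_class r M f -> uniq z -> size z = r ->
  (forall y, y \in z -> (y \in `]0, 1[) /\ f y = 0) -> x \in `[0, 1] ->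
  `|f x| <= M / r`!%:R * \prod_(y <- z) `|x - y|.
Proof.
move=> M0 ff uz sz zP x01.
have [/(continuous_within_itvP _ ltr01)[_ f0 f1] _ _ _] := ff.
pose P := \prod_(y <- z) ('X - y%:P).
have PE t : `|P.[t]| = \prod_(y <- z) `|t - y|.
  rewrite horner_prod normr_prod; apply: eq_bigr => y _.
  by rewrite hornerXsubC.
have cP : continuous (horner P) by apply: smooth_continuous; exact: smooth_horner.
pose u t := M / r`!%:R * `|P.[t]| - `|f t|.
have u0 t : t \in `]0, 1[ -> 0 <= u t.
  by move=> t01; rewrite subr_ge0 PE; exact: zeros_bound.
rewrite -PE -subr_ge0 -/(u x); move: x01; rewrite in_itv /= => /andP[].
rewrite le_eqVlt => /orP[/eqP <- _|x0].
  have ulim : u t @[t --> (0 : R)^'+] --> u 0.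
    apply: cvgB; last exact: cvg_norm.
    apply: cvgM; first exact: cvg_cst.
    by apply: cvg_norm; apply: cvg_at_right_filter; exact: cP.
  apply: (cvgr_to_ge ulim); near=> t; apply: u0; rewrite in_itv /=.
  by apply/andP; split; near: t; [exact: nbhs_right_gt|exact: nbhs_right_lt].
rewrite le_eqVlt => /orP[/eqP ->|x1]; last by apply: u0; rewrite in_itv /= x0.
have ulim : u t @[t --> (1 : R)^'-] --> u 1.
  apply: cvgB; last exact: cvg_norm.
  apply: cvgM; first exact: cvg_cst.
  by apply: cvg_norm; apply: cvg_at_left_filter; exact: cP.
apply: (cvgr_to_ge ulim); near=> t; apply: u0; rewrite in_itv /=.
by apply/andP; split; near: t; [exact: nbhs_left_gt|exact: nbhs_left_lt].
Unshelve. all: by end_near. Qed.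

Lemma prod_lt_expr (s : seq R) (g : R -> R) (l : R) : (0 < size s)%N ->
  (forall y, y \in s -> 0 <= g y < l) -> \prod_(y <- s) g y < l ^+ size s.
Proof.
elim: s => // y [|w s] IH _ H.
  by rewrite big_seq1 expr1; have /andP[] := H y (mem_head _ _).
have /andP[g0 gl] := H y (mem_head _ _).
have H' v : v \in w :: s -> 0 <= g v < l by move=> vs; apply: H; rewrite inE vs orbT.
rewrite big_cons [size _]/= exprS ltr_pM//; last exact: IH.
by rewrite big_seq prodr_ge0// => v /H'/andP[].
Qed.

(* Since the zeros are strictly inside the interval, |x - y| < l for all of them. *)
Lemma few_zeros r (M : R) f (u l x : R) (z : seq R) : (0 < r)%N -> 0 < M ->
  factor_class r M f -> 0 <= u -> u + l <= 1 -> u <= x <= u + l ->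
  M / r`!%:R * l ^+ r <= `|f x| -> uniq z ->
  (forall y, y \in z -> u < y < u + l /\ f y = 0) -> (size z < r)%N.
Proof.
move=> r0 M0 ff u0 ul xul fx uz zP; rewrite ltnNge; apply/negP => rz.
have zP' y : y \in take r z -> (y \in `]0, 1[) /\ f y = 0.
  by move=> /mem_take/zP[yul ->]; split=> //; rewrite in_itv /=; lra.
have x01 : x \in `[0, 1] by rewrite in_itv /=; lra.
have := zeros_bound_closed (ltW M0) ff (take_uniq r uz) (size_takel rz) zP' x01.
apply/negP; rewrite -ltNge; apply: lt_le_trans fx.
rewrite ltr_pM2l ?divr_gt0// ?ltr0n ?fact_gt0//.
rewrite -{2}(size_takel rz); apply: prod_lt_expr.
  by rewrite size_takel.
by move=> y /mem_take/zP[yul _]; rewrite normr_ge0 /= ltr_norml; lra.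
Qed.

End Zeros.

(** * Hitting sets *)

Section Greedy.
Context {R : realType} (X J : finType).
Variables (S : J -> {set X}) (D : {set J}).

Definition unhit (G : seq X) : {set J} :=
  [set j in D | all (fun x => x \notin S j) G].

(** If every set has density at least p, some point lies in at least a fraction p of the sets not
    yet hit; adding it leaves at most a fraction 1 - p of them. *)
Lemma greedy (p : R) t : 0 <= p <= 1 -> (0 < #|X|)%N ->
  (forall j, j \in D -> p * #|X|%:R <= #|S j|%:R) ->
  exists2 G : seq X, (size G <= t)%N & #|unhit G|%:R <= (1 - p) ^+ t * #|D|%:R.
Proof.
move=> p01 X0 HS; elim: t => [|t [G sG HG]].
  exists [::] => //; rewrite expr0 mul1r ler_nat subset_leq_card//.
  by apply/fintype.subsetP => j; rewrite inE => /andP[].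
pose U := unhit G.
(* By averaging over x: the pairs (x, j) with x in S j are counted in both orders. *)
have [x Hx] : exists x, p * #|U|%:R <= #|[set j in U | x \in S j]|%:R.
  apply/not_existsP => H.
  have : \sum_(x : X) (#|[set j in U | x \in S j]|%:R : R) < \sum_(x : X) p * #|U|%:R.
    apply: ltr_sum => [|x _]; last by rewrite ltNge; apply/negP => /H.
    by have /card_gt0P[x _] := X0; apply/hasP; exists x; rewrite ?mem_index_enum.
  apply/negP; rewrite -leNgt sumr_const -(mulr_natr (p * _)) mulrAC.
  rewrite (eq_bigr (fun x => \sum_(j in U) (x \in S j)%:R)); last first.
    move=> x _; rewrite -natr_sum; congr _%:R; rewrite -sum1_card big_mkcond /=.
    rewrite [RHS]big_mkcond /=; apply: eq_bigr => j _; rewrite inE.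
    by case: (j \in U) => //=; case: (x \in S j).
  rewrite exchange_big /=.
  have -> : p * #|X|%:R * #|U|%:R = \sum_(j in U) (p * #|X|%:R) by rewrite sumr_const mulr_natr.
  apply: ler_sum => j; rewrite inE => /andP[jD _]; rewrite -natr_sum.
  apply: le_trans (HS j jD) _; rewrite ler_nat -sum1_card.
  by rewrite [X in (X <= _)%N]big_mkcond /=; apply: leq_sum => x _; case: ifP => // ->.
exists (x :: G) => //.
have E : unhit (x :: G) = U :\: [set j in U | x \in S j].
  by apply/setP => j; rewrite !inE /=; case: (j \in D); case: (x \in S j); rewrite ?andbF ?andbT //= ?andbN //; case: all.
rewrite E cardsD (finset.setIidPr _); last by apply/fintype.subsetP => j; rewrite inE => /andP[].
rewrite natrB; last by rewrite subset_leq_card//; apply/fintype.subsetP => j; rewrite inE => /andP[].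
apply: (@le_trans _ _ ((1 - p) * #|U|%:R)); first by rewrite mulrBl mul1r lerD2l lerN2.
by rewrite exprS -mulrA ler_wpM2l// subr_ge0; have /andP[] := p01.
Qed.

(** After t > ln |D| / p greedy steps, at most exp(-p t) |D| < 1 sets are missed. *)
Lemma hitting_set (p : R) : 0 < p <= 1 -> (0 < #|X|)%N ->
  (forall j, j \in D -> p * #|X|%:R <= #|S j|%:R) -> (0 < #|D|)%N ->
  exists2 G : seq X, (size G)%:R <= ln #|D|%:R / p + 1 :> R &
    forall j, j \in D -> exists2 x, x \in G & x \in S j.
Proof.
move=> /andP[p0 p1] X0 HS D0; pose L : R := ln #|D|%:R / p.
have lnD : 0 <= ln #|D|%:R :> R by rewrite ln_ge0// ler1n.
have L0 : 0 <= L by rewrite divr_ge0// ltW.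
have p01 : 0 <= p <= 1 by rewrite ltW.
have [G sG HG] := greedy (Num.truncn L).+1 p01 X0 HS.
have /andP[tL Lt] := truncn_itv L0.
exists G; first by apply: le_trans (_ : ((Num.truncn L).+1%:R : R) <= _); rewrite ?ler_nat// -natr1 lerD2r.
move=> j jD; apply/not_exists2P => H.
suff : #|unhit G|%:R < 1 :> R.
  rewrite ltrn1 ltnS leqn0 cards_eq0 => /eqP U0.
  suff : j \in unhit G by rewrite U0 inE.
  rewrite inE jD; apply/allP => x xG; apply/negP => xS.
  by have [] := H x.
apply: le_lt_trans HG _.
have : (1 - p) ^+ (Num.truncn L).+1 <= expR (- (p * (Num.truncn L).+1%:R)).
  rewrite -mulNr expRM_natr lerXn2r ?nnegrE ?expR_ge0 ?subr_ge0//.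
  exact: expR_ge1Dx.
rewrite -(ler_pM2r (_ : 0 < #|D|%:R)) ?ltr0n// => /le_lt_trans; apply.
rewrite -[X in _ * X]lnK ?posrE ?ltr0n// -expRD -[X in _ < X]expR0 ltr_expR.
by rewrite addrC subr_lt0 mulrC -ltr_pdivrMr.
Qed.

End Greedy.

(** * Nets over finite fields *)

Section Hermite.
Variables (F : fieldType) (d : nat) (alpha : 'I_d -> F).
Hypothesis alpha_inj : injective alpha.
Implicit Types (k : 'I_d -> nat) (f h : {poly F}) (i : 'I_d).

(** The l-th Taylor coefficient of [f] at the node [alpha i]; it becomes the l-th digit of
    coordinate i of the point attached to [f]. *)
Definition taylor i l f : F := (f \Po ('X + (alpha i)%:P))`_l.

Lemma taylorD i l f h : taylor i l (f + h) = taylor i l f + taylor i l h.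
Proof. by rewrite /taylor comp_polyD coefD. Qed.

Definition node_poly k : {poly F} := \prod_i ('X - (alpha i)%:P) ^+ k i.

(** The first nonzero Taylor coefficient of [node_poly k] at [alpha i]. *)
Definition cofactor_at k i : F :=
  (\prod_(j | j != i) ('X - (alpha j)%:P) ^+ k j).[alpha i].

Lemma cofactor_at_neq0 k i : cofactor_at k i != 0.
Proof.
rewrite /cofactor_at horner_prod; apply/prodf_neq0 => j ji.
by rewrite horner_exp hornerXsubC expf_neq0// subr_eq0 (inj_eq alpha_inj) eq_sym.
Qed.

Lemma monic_node_poly k : node_poly k \is monic.
Proof. by apply: monic_prod => i _; rewrite monic_exp// monicXsubC. Qed.

Lemma size_node_poly k : size (node_poly k) = (\sum_i k i).+1.
Proof.
rewrite size_prod; last by move=> i _; rewrite expf_neq0// polyXsubC_eq0.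
rewrite (eq_bigr (fun i => (k i).+1)); last by move=> i _; rewrite size_exp_XsubC.
rewrite (eq_bigr (fun i => (k i + 1)%N)); last by move=> i _; rewrite addn1.
by rewrite big_split /= sum1_card -addSn addnK.
Qed.

(** Adding a multiple of the node polynomial thus keeps the first [k i] digits at each node and
    shifts the next one by a multiple of the value of h there. *)
Lemma taylor_node_mul k i l h : (l <= k i)%N ->
  taylor i l (node_poly k * h) = (cofactor_at k i * h.[alpha i]) *+ (l == k i).
Proof.
move=> lk; rewrite /taylor /node_poly (bigD1 i)//= -mulrA comp_polyM.
have -> : (('X - (alpha i)%:P) ^+ k i) \Po ('X + (alpha i)%:P) = 'X^(k i).
  rewrite rmorphXn /= comp_polyB comp_polyX comp_polyC addrK //.
rewrite coefXnM; case: eqP => [->|/eqP lk'].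
  rewrite ltnn subnn -horner_coef0 horner_comp hornerD hornerX hornerC add0r.
  by rewrite hornerM mulr1n.
by rewrite ifT ?mulr0n// ltn_neqAle lk'.
Qed.

(* Newton interpolation: the coefficients are prescribed one at a time. *)
Lemma hermite_interpolation k (t : 'I_d -> nat -> F) :
  exists2 f : {poly F}, (size f <= \sum_i k i)%N &
    forall i l, (l < k i)%N -> taylor i l f = t i l.
Proof.
move En : (\sum_i k i)%N => n; elim: n k En => [|n IH] k En.
  exists 0; first by rewrite size_poly0.
  move=> i l; suff -> : k i = 0%N by [].
  by move/eqP: En; rewrite sum_nat_eq0 => /forallP/(_ i)/eqP.
case: (pickP (fun i => 0 < k i)%N) => [i0 ki0|k0]; last first.
  by move: En; rewrite big1// => i _; move/negbT: (k0 i); rewrite -eqn0Ngt => /eqP.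
pose k' i := if i == i0 then (k i).-1 else k i.
have [|f sf fP] := IH k'.
  move: En; rewrite (bigD1 i0)//= [in X in _ -> X](bigD1 i0)//= {1}/k' eqxx.
  rewrite [in X in _ -> X](eq_bigr k) => [|i /negbTE ii0]; last by rewrite /k' ii0.
  by case: (k i0) ki0 => // m _; rewrite addSn => -[].
pose c := (t i0 (k' i0) - taylor i0 (k' i0) f) / cofactor_at k' i0.
exists (f + node_poly k' * c%:P).
  apply: leq_trans (size_polyD _ _) _; rewrite geq_max leqW //=.
  apply: leq_trans (size_polyMleq _ _) _.
  rewrite size_node_poly size_polyC.
  have -> : (\sum_i k' i)%N = n.
    move: En; rewrite (bigD1 i0)//= [in X in _ -> X](bigD1 i0)//= {1}/k' eqxx.
    rewrite [in X in _ -> X](eq_bigr k) => [|i /negbTE ii0]; last by rewrite /k' ii0.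
    by case: (k i0) ki0 => // m _; rewrite addSn => -[].
  by case: (c != 0); rewrite ?addn0 ?addn1.
move=> i l lk; rewrite taylorD.
have [ii0|ii0] := eqVneq i i0; last first.
  have kk : k' i = k i by rewrite /k' (negbTE ii0).
  have lk' : (l < k' i)%N by rewrite kk.
  by rewrite fP// (taylor_node_mul _ (ltnW lk')) (ltn_eqF lk') mulr0n addr0.
rewrite ii0 in lk *; have lk' : (l <= k' i0)%N by rewrite /k' eqxx; case: (k i0) lk.
rewrite taylor_node_mul// hornerC; move: lk'; rewrite leq_eqVlt => /orP[/eqP->|lk'].
  by rewrite eqxx mulr1n mulrC divfK ?cofactor_at_neq0// addrC subrK.
by rewrite (ltn_eqF lk') mulr0n addr0 fP.
Qed.

(** For h of degree less than d, this matrix sends the coefficients of h to those of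
    [node_poly k * h] from degree sum k on, and [next_mx] sends them to the shifts of the next
    digits. *)
Definition leading_mx k : 'M[F]_d :=
  \matrix_(j, l) (node_poly k * 'X^j)`_(\sum_i k i + l).

Definition next_mx k : 'M[F]_d := \matrix_(j, i) (cofactor_at k i * alpha i ^+ j).

Lemma rVpoly_sum (v : 'rV[F]_d) : rVpoly v = \sum_j v 0 j *: 'X^j.
Proof. by rewrite [LHS]poly_def; apply: eq_bigr => j _; rewrite valK. Qed.

Lemma size_rVpoly m (v : 'rV[F]_m) : (size (rVpoly v) <= m)%N.
Proof. exact: size_poly. Qed.

Lemma mul_leading_mx k (h : 'rV[F]_d) l :
  (h *m leading_mx k) 0 l = (node_poly k * rVpoly h)`_(\sum_i k i + l).
Proof.
rewrite mxE rVpoly_sum mulr_sumr coef_sum; apply: eq_bigr => j _.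
by rewrite mxE -scalerAr coefZ.
Qed.

Lemma mul_next_mx k (h : 'rV[F]_d) i :
  (h *m next_mx k) 0 i = cofactor_at k i * (rVpoly h).[alpha i].
Proof.
rewrite mxE rVpoly_sum horner_sum mulr_sumr; apply: eq_bigr => j _.
by rewrite mxE hornerZ hornerXn mulrCA.
Qed.

Lemma unitmx_inj (A : 'M[F]_d) :
  (forall h : 'rV[F]_d, h *m A = 0 -> h = 0) -> A \in unitmx.
Proof.
move=> Ainj; rewrite -row_free_unit -kermx_eq0; apply/eqP/row_matrixP => i.
by rewrite row0; apply: Ainj; rewrite -row_mul mulmx_ker row0.
Qed.

Lemma rVpoly_eq0 (h : 'rV[F]_d) : rVpoly h = 0 -> h = 0.
Proof. by move=> h0; rewrite -[h]rVpolyK h0 linear0. Qed.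

(** The node polynomial is monic of degree sum k, so the leading coefficient of its product with a
    nonzero h is among the entries retained. *)
Lemma leading_mx_unit k : leading_mx k \in unitmx.
Proof.
apply: unitmx_inj => h hA; apply: rVpoly_eq0; apply/eqP; rewrite -size_poly_eq0.
set p := rVpoly h; case E : (size p) => [//|m].
have md : (m < d)%N by rewrite -E size_rVpoly.
have p0 : p != 0 by rewrite -size_poly_gt0 E.
have := congr1 (fun v : 'rV_d => v 0 (Ordinal md)) hA.
rewrite mul_leading_mx mxE /= -/p => H.
have : lead_coef (node_poly k * p) = 0.
  by rewrite lead_coefE size_monicM ?monic_node_poly// size_node_poly E addnS.
move/eqP; rewrite lead_coef_eq0 mulf_eq0 (negbTE p0) orbF => /eqP q0.
by have := monic_neq0 (monic_node_poly k); rewrite q0 eqxx.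
Qed.

(** A polynomial of degree less than d that vanishes at the d distinct nodes is zero. *)
Lemma next_mx_unit k : next_mx k \in unitmx.
Proof.
apply: unitmx_inj => h hB; apply: rVpoly_eq0.
apply: (@roots_geq_poly_eq0 _ _ [seq alpha i | i <- enum 'I_d]).
- apply/allP => x /mapP[i _ ->]; apply/rootP/eqP.
  have := congr1 (fun v : 'rV_d => v 0 i) hB.
  rewrite mul_next_mx mxE => /eqP; rewrite mulf_eq0.
  by rewrite (negbTE (cofactor_at_neq0 k i)).
- by rewrite map_inj_uniq ?enum_uniq.
- by rewrite size_map size_enum_ord size_rVpoly.
Qed.

(** The d top coefficients [g] are kept apart because they alone come from a hitting set; the low
    ones [f0] run through all values. *)
Definition net_poly n (g : 'rV[F]_d) (f0 : 'rV[F]_n) : {poly F} :=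
  'X^n * rVpoly g + rVpoly f0.

Lemma net_poly_digits k (t : 'I_d -> nat -> F) : exists w : 'rV[F]_d,
  forall h : 'rV[F]_d, exists f0 : 'rV[F]_(\sum_i k i),
    (forall i l, (l < k i)%N -> taylor i l (net_poly (h *m leading_mx k) f0) = t i l) /\
    (forall i, taylor i (k i) (net_poly (h *m leading_mx k) f0) =
      (h *m next_mx k + w) 0 i).
Proof.
have [p sp pP] := hermite_interpolation k t.
exists (\row_i taylor i (k i) p) => h.
pose f := node_poly k * rVpoly h + p.
exists (poly_rV f).
have -> : net_poly (n := \sum_i k i) (h *m leading_mx k) (poly_rV f) = f.
  set n := (\sum_i k i)%N in sp *.
  rewrite /net_poly; apply/polyP => m; rewrite coefD coefXnM.
  case: ltnP => [mn|nm].
    by rewrite coef_rVpoly insubT mxE add0r.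
  rewrite [(rVpoly (poly_rV f))`_m]nth_default ?addr0; last first.
    exact: leq_trans (size_rVpoly _) nm.
  rewrite coef_rVpoly.
  case: insubP => [l _ lE|].
    rewrite mul_leading_mx lE -/n subnKC// coefD [p`_m]nth_default ?addr0//.
    exact: leq_trans sp nm.
  rewrite -leqNgt => dm; rewrite nth_default//.
  apply: leq_trans (size_polyD _ _) _; rewrite geq_max (leq_trans sp nm) andbT.
  apply: leq_trans (size_polyMleq _ _) _; rewrite size_node_poly -/n addSn /=.
  by rewrite -(subnKC nm) leq_add2l (leq_trans (size_rVpoly h)).
split=> [i l lk|i]; rewrite taylorD taylor_node_mul ?(ltnW lk)//.
  by rewrite ltn_eqF// mulr0n add0r pP.
by rewrite eqxx mulr1n !mxE; congr (_ + _); rewrite -mul_next_mx mxE.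
Qed.

End Hermite.

(** * Hitting sets for the top coefficients *)

Section HittingRows.
Variables (F : finFieldType) (d b : nat).
Hypotheses (d0 : (0 < d)%N) (b0 : (0 < b)%N) (cF : #|F| = (2 ^ b)%N).

(** When F is numbered by b-bit integers, these are the elements whose r leading bits form j. *)
Definition block (r j : nat) : {set F} :=
  [set y : F | (enum_rank y %/ 2 ^ (b - r) == j)%N].

Lemma card_block r j : (r <= b)%N -> (j < 2 ^ r)%N ->
  (2 ^ (b - r) <= #|block r j|)%N.
Proof.
move=> rb j2; set m := (2 ^ (b - r))%N.
have m0 : (0 < m)%N by rewrite expn_gt0.
have lt a : (a < m)%N -> (j * m + a < #|F|)%N.
  move=> am; rewrite cF -(subnKC rb) expnD -/m.
  apply: (@leq_trans (j.+1 * m)); last by rewrite leq_mul2r j2 orbT.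
  by rewrite mulSn addnC ltn_add2r.
pose e (a : 'I_m) : F := enum_val (Ordinal (lt a (ltn_ord a))).
have e_inj : injective e.
  by move=> a a' /enum_val_inj/(congr1 val)/= /addnI /val_inj.
rewrite -[leqLHS]card_ord -(card_imset predT e_inj) subset_leq_card//.
apply/fintype.subsetP => _ /imsetP[a _ ->].
by rewrite inE enum_valK /= divnMDl// divn_small// addn0.
Qed.

(** A box enters only through two matrices, a shift and, for each coordinate, the number of bits
    demanded of the next digit and their value. The number of events therefore depends on b and d
    alone. *)
Definition event : finType :=
  ('M[F]_d * 'M[F]_d * 'rV[F]_d * {ffun 'I_d -> 'I_b} * {ffun 'I_d -> 'I_(2 ^ b)})%type.

Definition event_set (e : event) : {set 'rV[F]_d} :=
  let: (A, B, w, r, j) := e in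
  [set g | [exists h : 'rV[F]_d, (g == h *m A) &&
     [forall i, (h *m B + w) 0 i \in block (r i) (j i)]]].

Definition events s : {set event} :=
  [set e : event | let: (A, B, w, r, j) := e in
    [&& A \in unitmx, B \in unitmx, (\sum_i r i == s)%N &
        [forall i, (j i < 2 ^ r i)%N]]].

(** The top coefficients and the next digits determine each other affinely, so the density is at
    least that of the product of the blocks, namely 2^-s. *)
Lemma card_event_set s e : e \in events s ->
  (2 ^ (b * d) <= #|event_set e| * 2 ^ s)%N.
Proof.
case: e => [[[[A B] w] r] j]; rewrite inE => /and4P[uA uB /eqP rs /forallP jr].
pose T i := block (r i) (j i).
pose u (phi : {ffun 'I_d -> F}) : 'rV[F]_d := (\row_i phi i - w) *m invmx B *m A.
have u_inj : injective u.
  move=> p p' /(can_inj (mulmxK uA)) /(can_inj (mulmxKV uB)) /addIr /rowP pp.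
  by apply/ffunP => i; have := pp i; rewrite !mxE.
have -> : (2 ^ (b * d) = (\prod_i 2 ^ (b - r i)) * 2 ^ s)%N.
  rewrite -rs expn_sum -big_split /=.
  rewrite (eq_bigr (fun=> 2 ^ b)%N) => [|i _]; last by rewrite -expnD subnK// ltnW.
  by rewrite prod_nat_const card_ord expnM.
rewrite leq_mul2r; apply/orP; right.
apply: (@leq_trans #|family (fun i => mem (T i))|).
  rewrite card_family foldrE big_map big_enum /=.
  by apply: leq_prod => i _; apply: card_block => //; exact: ltnW.
rewrite -(card_imset _ u_inj) subset_leq_card//.
apply/fintype.subsetP => _ /imsetP[phi /familyP phiT ->].
rewrite inE; apply/existsP; exists ((\row_i phi i - w) *m invmx B).
rewrite eqxx /=; apply/forallP => i.
by rewrite mulmxKV// subrK mxE; exact: phiT.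
Qed.

Lemma card_event : (#|event| <= 2 ^ (5 * b * d ^ 2))%N.
Proof.
rewrite !card_prod !card_mx !card_ffun !card_ord cF -!expnM.
apply: (@leq_trans (2 ^ (b * (d * d)) * 2 ^ (b * (d * d)) * 2 ^ (b * (1 * d)) *
  2 ^ (b * d) * 2 ^ (b * d))%N).
  by rewrite !leq_mul2r leq_mul2l expnM leq_exp2r// ltnW ?orbT// ltn_expl.
rewrite -!expnD leq_exp2l//.
have : (b * d <= b * (d * d))%N by rewrite leq_mul2l leq_pmulr ?orbT.
rewrite expnS expn1 mul1n; nia.
Qed.

(** The greedy bound for density 2^-s and at most 2^(5 b d^2) events; the 6 absorbs the additional
    1. *)
Lemma hitting_rows (R : realType) s : exists2 G : seq 'rV[F]_d,
  (size G <= 2 ^ s * (6 * b * d ^ 2))%N &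
  forall e, e \in events s -> exists2 g, g \in G & g \in event_set e.
Proof.
have [D0|D0] := posnP #|events s|.
  by exists [::] => // e; move/eqP: D0; rewrite cards_eq0 => /eqP ->; rewrite inE.
have q0 : (0 : R) < 2 ^+ s by rewrite exprn_gt0.
have p01 : 0 < (2 ^+ s : R)^-1 <= 1 by rewrite invr_gt0 q0 invf_le1// exprn_ege1// ler1n.
have X0 : (0 < #|{: 'rV[F]_d}|)%N by rewrite card_mx expn_gt0 cF expn_gt0.
have [|G sG GP] := @hitting_set R _ _ event_set (events s) _ p01 X0 _ D0.
  move=> e /card_event_set; rewrite card_mx cF mul1n -expnM => H.
  by rewrite mulrC ler_pdivrMr// -natrX -natrM ler_nat.
exists G => //; rewrite -(ler_nat R); apply: le_trans sG _.
have lnD : ln #|events s|%:R <= (5 * b * d ^ 2)%:R :> R.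
  apply: (@le_trans _ _ (ln (2 ^+ (5 * b * d ^ 2) : R))).
    rewrite ler_ln ?posrE ?ltr0n// ?exprn_gt0// -natrX ler_nat.
    by apply: leq_trans (max_card _) card_event.
  rewrite lnXn// -(mulr_natr (ln 2)) ler_piMl//.
  have := @le_ln1Dx R 1; rewrite -[1 + 1]/(2 : R); apply; lra.
rewrite invrK; have s1 : (1 : R) <= 2 ^+ s by rewrite exprn_ege1// ler1n.
apply: (@le_trans _ _ (((5 * b * d ^ 2)%:R + 1) * 2 ^+ s)).
  by rewrite mulrDl mul1r lerD// ler_wpM2r// ltW.
rewrite natr1 -natrX -natrM ler_nat mulnC leq_mul2l.
apply/orP; right.
have : (0 < b * d ^ 2)%N by rewrite muln_gt0 b0 expn_gt0 d0.
by rewrite -!mulnA; lia.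
Qed.

End HittingRows.

(** * Expansions in base q *)

Section Digits.
Variable q : nat.
Hypothesis q0 : (0 < q)%N.
Implicit Types c : nat -> nat.

Fixpoint num c m : nat := if m is m'.+1 then (num c m' * q + c m')%N else 0%N.

Lemma num_div c m m' : (forall l, c l < q)%N -> (m <= m')%N ->
  (num c m' %/ q ^ (m' - m) = num c m)%N.
Proof.
move=> cq; elim: m' => [|m' IH]; first by rewrite leqn0 => /eqP ->; rewrite divn1.
rewrite leq_eqVlt => /orP[/eqP ->|mm']; first by rewrite subnn divn1.
by rewrite subSn// expnS divnMA /= divnMDl// (divn_small (cq m')) addn0 IH.
Qed.

Lemma num_lt c m : (forall l, c l < q)%N -> (num c m < q ^ m)%N.
Proof.
move=> cq; elim: m => //= m IH; apply: (@leq_trans ((num c m).+1 * q)).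
  by rewrite mulSn addnC ltn_add2r.
by rewrite expnSr leq_mul2r IH orbT.
Qed.

Lemma eq_num c c' m : (forall l, l < m -> c l = c' l)%N -> num c m = num c' m.
Proof.
elim: m => //= m IH H; rewrite IH ?H// => l lm; apply: H; exact: ltnW.
Qed.

Lemma num_surj v m : (v < q ^ m)%N ->
  exists2 c, (forall l, c l < q)%N & num c m = v.
Proof.
elim: m v => [|m IH] v; first by case: v => // _; exists (fun=> 0%N).
rewrite expnSr -ltn_divLR// => /IH[c cq cv].
exists (fun l => if l == m then v %% q else c l)%N.
  by move=> l; case: ifP => // _; rewrite ltn_mod.
rewrite /= eqxx (@eq_num _ c) ?cv -?divn_eq// => l lm.
by rewrite ltn_eqF.
Qed.

End Digits.

(** * The net on an integer grid *)

Section Net.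
Variables (d K : nat).
Hypothesis d0 : (0 < d)%N.

(** In GF(2^d) a digit carries d bits and d distinct nodes exist. Of the [k i] bits demanded, k i /
    d full digits are prescribed exactly and the remaining r i < d bits constrain the next digit.
    With s the sum of the r i, about 2^s top parts and at most 2^(K - s) low parts give order 2^K
    for each of at most d^2 values of s. *)
Lemma dyadic_net_nat (R : realType) : exists P : seq {ffun 'I_d -> nat},
  [/\ (size P <= 6 * d ^ 5 * 2 ^ K)%N,
      forall x i, x \in P -> (x i < 2 ^ (d * K.+1))%N &
      forall k j : 'I_d -> nat, (\sum_i k i = K)%N -> (forall i, j i < 2 ^ k i)%N ->
        exists2 x, x \in P & forall i, (x i %/ 2 ^ (d * K.+1 - k i) = j i)%N].
Proof.
have [F _ cF] := @PrimePowerField 2 d isT d0.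
have dF : (d <= #|F|)%N by rewrite cF ltnW// ltn_expl.
pose alpha (i : 'I_d) : F := enum_val (widen_ord dF i).
have alpha_inj : injective alpha.
  by move=> i i' /enum_val_inj/(congr1 val)/= /val_inj.
pose G s := projT1 (cid2 (hitting_rows d0 d0 cF R s)).
have sG s : (size (G s) <= 2 ^ s * (6 * d * d ^ 2))%N.
  by rewrite /G; case: cid2.
have GP s e : e \in events F d d s -> exists2 g, g \in G s & g \in event_set e.
  by rewrite /G; case: cid2 => /= ? _; apply.
pose c f i l : nat := enum_rank (taylor alpha i l f).
have cq f i l : (c f i l < 2 ^ d)%N by rewrite -cF; exact: ltn_ord.
pose pt f : {ffun 'I_d -> nat} := [ffun i => num (2 ^ d) (c f i) K.+1].
(* If s bits fall into partial digits, (K - s) / d full digits are prescribed in all; this is the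
   number of low coefficients. *)
pose Ps s := if (s <= K)%N then
  [seq pt (net_poly g f0) | g <- G s, f0 <- enum {: 'rV[F]_((K - s) %/ d)}] else [::].
exists (flatten [seq Ps s | s <- iota 0 (d * d)]); split.
- rewrite size_flatten sumnE !big_map.
  apply: (@leq_trans (\sum_(s <- iota 0 (d * d)) 2 ^ K * (6 * d ^ 3))%N); last first.
    rewrite big_const_seq count_predT size_iota iter_addn_0.
    by rewrite !expnS expn0; lia.
  apply: leq_sum => s _; rewrite /Ps; case: ifP => // sK.
  rewrite size_allpairs -cardE card_mx cF mul1n -expnM.
  apply: leq_trans (leq_mul (sG s) (leqnn _)) _.
  rewrite mulnAC -expnD -mulnA -expnS leq_mul2r leq_exp2l//; apply/orP; right.
  by rewrite -leq_subRL// mulnC leq_trunc_div.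
- move=> x i /flattenP[_ /mapP[s _ ->]]; rewrite /Ps; case: ifP => // _.
  move=> /allpairsP[[g f0] [_ _ ->]]; rewrite ffunE expnM num_lt//.
move=> k j kK jk.
pose k' i := (k i %/ d)%N.
pose r i : 'I_d := Ordinal (ltn_pmod (k i) d0).
have kE i : k i = (k' i * d + r i)%N by rewrite /= -divn_eq.
pose s := (\sum_i r i)%N.
have sE : ((\sum_i k' i) * d + s = K)%N.
  by rewrite big_distrl -big_split -kK; apply: eq_bigr => i _; rewrite [RHS]kE.
have qd : (0 < 2 ^ d)%N by rewrite expn_gt0.
have jd i : (j i %/ 2 ^ r i < (2 ^ d) ^ k' i)%N.
  by rewrite ltn_divLR ?expn_gt0// -expnM -expnD mulnC -kE.
pose cj i := projT1 (cid2 (num_surj qd (jd i))).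
have cjq i l : (cj i l < 2 ^ d)%N by rewrite /cj; case: cid2.
have cjE i : num (2 ^ d) (cj i) (k' i) = (j i %/ 2 ^ r i)%N by rewrite /cj; case: cid2.
have cjF i l : (cj i l < #|F|)%N by rewrite cF.
pose t i l : F := enum_val (Ordinal (cjF i l)).
have [w wP] := net_poly_digits alpha_inj k' t.
have jm i : (j i %% 2 ^ r i < 2 ^ d)%N.
  apply: (@leq_trans (2 ^ r i)); first by rewrite ltn_mod expn_gt0.
  by rewrite leq_exp2l// ltnW.
pose e : event F d d := (leading_mx alpha k', next_mx alpha k', w, [ffun i => r i],
  [ffun i => Ordinal (jm i)]).
have es : e \in events F d d s.
  rewrite inE /= leading_mx_unit next_mx_unit//=; apply/andP; split.
    by apply/eqP/eq_bigr => i _; rewrite ffunE.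
  by apply/forallP => i; rewrite !ffunE /= ltn_mod expn_gt0.
have [g gG] := GP s e es.
rewrite inE => /existsP[h /andP[/eqP gh /forallP hT]].
have [f0 [fd fn]] := wP h.
have En : (\sum_i k' i)%N = ((K - s) %/ d)%N.
  by rewrite -sE addnK mulnK.
have sK : (s <= K)%N by rewrite -sE leq_addl.
have sdd : (s < d * d)%N.
  have : (s + d <= d * d)%N.
    have -> : (d * d = \sum_(i < d) d)%N by rewrite sum_nat_const card_ord.
    have -> : (s + d = \sum_i (r i + 1))%N by rewrite big_split /= sum1_card card_ord.
    apply: leq_sum => i _.
    by rewrite addn1 ltn_ord.
  by apply: leq_trans; rewrite -addn1 leq_add2l.
have inP n (u : 'rV[F]_n) : n = ((K - s) %/ d)%N ->
    pt (net_poly g u) \in flatten [seq Ps s | s <- iota 0 (d * d)].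
  move=> nE; apply/flattenP; exists (Ps s).
    by apply/mapP; exists s => //; rewrite mem_iota.
  rewrite /Ps sK; move: u; rewrite nE => u; apply/allpairsP.
  by exists (g, u); rewrite mem_enum.
exists (pt (net_poly g f0)); first exact: inP.
move=> i; rewrite ffunE; set f := net_poly g f0.
have k'K : (k' i < K.+1)%N.
  rewrite ltnS; apply: (@leq_trans (k i)); first exact: leq_div.
  by rewrite -kK (bigD1 i)//= leq_addr.
have ri : (r i < d)%N by [].
(* The division keeps k' i + 1 digits, the last of them reduced to its r i leading bits. *)
have -> : (d * K.+1 - k i = d * (K.+1 - (k' i).+1) + (d - r i))%N.
  rewrite kE mulnBr mulnS; have : (d * (k' i).+1 <= d * K.+1)%N by rewrite leq_mul2l k'K orbT.
  rewrite mulnS (mulnC (k' i)); lia.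
rewrite expnD expnM divnMA num_div//=.
have -> : num (2 ^ d) (c f i) (k' i) = num (2 ^ d) (cj i) (k' i).
  by apply: eq_num => l lk; rewrite /c /f gh fd// /t enum_valK.
have dE : (2 ^ d = 2 ^ r i * 2 ^ (d - r i))%N by rewrite -expnD subnKC// ltnW.
rewrite cjE dE mulnA divnMDl ?expn_gt0//.
have := hT i; rewrite -fn -gh -/f !ffunE inE => /eqP ->.
by rewrite /= -divn_eq.
Qed.

End Net.

(** * Dyadic boxes in the cube *)

Section CubeNet.
Context {R : realType}.

Fact clamp_ge0 (x : R) : 0 <= Num.max 0 (Num.min 1 x).
Proof. by rewrite le_max lexx. Qed.

Fact clamp_le1 (x : R) : Num.max 0 (Num.min 1 x) <= 1.
Proof. by rewrite ge_max ler01 ge_min lexx. Qed.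

Definition to01 (x : R) : {i01 R} := Itv01 (clamp_ge0 x) (clamp_le1 x).

Lemma to01E (x : R) : 0 <= x <= 1 -> (to01 x)%:num = x.
Proof. by move=> /andP[x0 x1]; rewrite /= (min_idPr x1) (max_idPr x0). Qed.

Lemma dyadic_digits (N k p j : nat) : (k <= N)%N -> (p %/ 2 ^ (N - k) = j)%N ->
  j%:R / 2 ^+ k <= (p%:R / 2 ^+ N : R) < j.+1%:R / 2 ^+ k.
Proof.
move=> kN <-; set q := (2 ^ (N - k))%N.
have q0 : (0 < q)%N by rewrite expn_gt0.
have E : 2 ^+ N = 2 ^+ k * q%:R :> R by rewrite natrX -exprD subnKC.
have k0 : 0 < 2 ^+ k :> R by rewrite exprn_gt0.
have qR : 0 < q%:R :> R by rewrite ltr0n.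
rewrite ler_pdivrMr// ltr_pdivlMr// E.
have -> : p%:R / (2 ^+ k * q%:R) * 2 ^+ k = p%:R / q%:R :> R.
  by field; rewrite !gt_eqF.
rewrite ler_pdivlMr// ltr_pdivrMr// -!natrM ler_nat ltr_nat leq_trunc_div /=.
by rewrite -ltn_divLR.
Qed.

(** A box of order below K is shrunk to order exactly K by appending the missing bits, all zero, at
    coordinate [i0]. *)
Lemma dyadic_net_pad d K : (0 < d)%N -> exists P : seq (cube R d),
  (size P <= 6 * d ^ 5 * 2 ^ K)%N /\
  forall k j : 'I_d -> nat, (\sum_i k i <= K)%N -> (forall i, j i < 2 ^ k i)%N ->
    exists2 x, x \in P & forall i,
      (j i)%:R / 2 ^+ k i <= (x i)%:num < (j i).+1%:R / 2 ^+ k i.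
Proof.
move=> d0; have [P [sP PN HP]] := dyadic_net_nat K d0 R.
set N := (d * K.+1)%N in PN HP.
exists [seq [ffun i => to01 ((p i)%:R / 2 ^+ N)] | p : {ffun 'I_d -> nat} <- P].
split; first by rewrite size_map.
move=> k j kK jk; pose i0 := Ordinal d0; pose D := (K - \sum_i k i)%N.
pose k' i := (k i + (i == i0) * D)%N; pose j' i := (j i * 2 ^ ((i == i0) * D))%N.
have k'K : (\sum_i k' i = K)%N.
  rewrite big_split /= [X in (_ + X)%N](bigD1 i0)//= ?eqxx ?mul1n.
  by rewrite [X in (_ + (_ + X))%N]big1 ?addn0 ?subnKC// => i /negbTE ->.
have j'k i : (j' i < 2 ^ k' i)%N.
  by rewrite /j' /k' expnD ltn_pmul2r ?expn_gt0.
have [p pP pj] := HP _ _ k'K j'k.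
exists [ffun i => to01 ((p i)%:R / 2 ^+ N)]; first by apply/mapP; exists p.
have N0 : 0 < 2 ^+ N :> R by rewrite exprn_gt0.
move=> i; rewrite ffunE to01E; last first.
  apply/andP; split; first by rewrite divr_ge0// ltW.
  rewrite ler_pdivrMr// mul1r -natrX ler_nat ltnW//.
  exact: PN.
have kN : (k' i <= N)%N.
  apply: (@leq_trans K); first by rewrite -k'K (bigD1 i)//= leq_addr.
  by apply: leq_trans (leqnSn K) _; rewrite leq_pmull.
apply: dyadic_digits; first by apply: leq_trans kN; exact: leq_addr.
have := pj i; rewrite /k' /j'; move: kN; rewrite /k'; set E := ((i == i0) * D)%N => kN pE.
have -> : (N - k i = N - (k i + E) + E)%N by lia.
by rewrite expnD divnMA pE mulnK ?expn_gt0.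
Qed.

(** K is the integer part of log2 B, and d^5 <= 32^d because d < 2^d. *)
Lemma dyadic_net d (B : R) : (0 < d)%N -> 1 <= B -> exists P : seq (cube R d),
  (size P)%:R <= 6 * 32 ^+ d * B /\
  forall k j : 'I_d -> nat, \prod_i (2 ^+ k i : R) <= B -> (forall i, j i < 2 ^ k i)%N ->
    exists2 x, x \in P & forall i,
      (j i)%:R / 2 ^+ k i <= (x i)%:num < (j i).+1%:R / 2 ^+ k i.
Proof.
move=> d0 B1; pose K := trunc_log 2 (Num.truncn B).
have B0 : 0 <= B by rewrite (le_trans _ B1).
have /andP[tB Bt] := truncn_itv B0.
have t0 : (0 < Num.truncn B)%N by rewrite truncn_gt0.
have /andP[Kt tK] := trunc_log_bounds (isT : (1 < 2)%N) t0.
have [P [sP HP]] := dyadic_net_pad K d0.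
exists P; split.
  apply: (@le_trans _ _ (6 * d ^ 5 * 2 ^ K)%:R); first by rewrite ler_nat.
  rewrite natrM ler_pM//; last by apply: le_trans tB; rewrite ler_nat.
  rewrite -natrX -natrM ler_nat leq_mul2l /= (_ : 32 = 2 ^ 5)%N// -expnM mulnC expnM leq_exp2r//.
  by rewrite ltnW// ltn_expl.
move=> k j kB jk; apply: HP => //.
rewrite -ltnS -(ltn_exp2l _ _ (isT : (1 < 2)%N)).
apply: leq_ltn_trans tK; rewrite -ltnS -(ltr_nat R); apply: le_lt_trans Bt.
apply: le_trans kB; rewrite natrX.
by rewrite expr_sum.
Qed.

End CubeNet.

(** * Zero-free dyadic intervals for one factor *)

Section Boxes.
Context {R : realType}.
Variables (r : nat) (M : R).
Hypotheses (r0 : (0 < r)%N) (M0 : 0 < M).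
Implicit Types (f : R -> R) (x l : R).

Lemma few_zeros_window f x l : factor_class r M f -> 0 <= x <= 1 -> 0 < l <= 1 ->
  M / r`!%:R * l ^+ r <= `|f x| ->
  exists u, [/\ 0 <= u, u + l <= 1 & forall z : seq R, uniq z ->
    (forall y, y \in z -> u < y < u + l /\ f y = 0) -> (size z < r)%N].
Proof.
move=> ff x01 l01 fx; exists (Num.min x (1 - l)).
have [xl|lx] := leP x (1 - l).
  split; [lra|lra|move=> z uz zP].
  by apply: (few_zeros r0 M0 ff _ _ _ fx uz zP); lra.
split; [lra|lra|move=> z uz zP].
by apply: (few_zeros r0 M0 ff _ _ _ fx uz zP); lra.
Qed.

(* Among r consecutive dyadic intervals inside the window, one contains no zero. *)
Lemma dyadic_zero_free f x l k : factor_class r M f -> 0 <= x <= 1 -> 0 < l <= 1 ->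
  M / r`!%:R * l ^+ r <= `|f x| -> r.+1%:R <= l * 2 ^+ k ->
  exists2 j, (j < 2 ^ k)%N &
    forall y, j%:R / 2 ^+ k <= y < j.+1%:R / 2 ^+ k -> f y != 0.
Proof.
move=> ff x01 l01 fx rl; have [u [u0 ul uP]] := few_zeros_window ff x01 l01 fx.
have k0 : 0 < 2 ^+ k :> R by rewrite exprn_gt0.
(* The zeros have to lie strictly to the right of u; this uses up one interval, whence r + 1 in the
   hypothesis. *)
pose j0 := (Num.truncn (u * 2 ^+ k)).+1.
have /andP[tu ut] : (Num.truncn (u * 2 ^+ k))%:R <= u * 2 ^+ k < j0%:R.
  by apply: truncn_itv; rewrite mulr_ge0// ltW.
have jb a : (a < r)%N -> (j0 + a).+1%:R <= (u + l) * 2 ^+ k.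
  move=> ar; have : (j0 + a).+1%:R <= (Num.truncn (u * 2 ^+ k) + r.+1)%:R :> R.
    by rewrite ler_nat addnS ltnS addSn -addnS leq_add2l.
  by move/le_trans; apply; rewrite natrD mulrDl lerD.
apply/not_exists2P => H.
have jk a : (a < r)%N -> (j0 + a < 2 ^ k)%N.
  move=> /jb H1; rewrite -(ler_nat R) natrX; apply: le_trans H1 _.
  by rewrite -[leRHS]mul1r ler_wpM2r// ltW.
have /choice[y yP] : forall a, exists y, (a < r)%N -> [/\ (j0 + a)%:R <= y * 2 ^+ k,
    y * 2 ^+ k < (j0 + a).+1%:R & f y = 0].
  move=> a; have [ar|] := boolP (a < r)%N; last by exists 0.
  have [/(_ (jk a ar))//|/existsNP[y /not_implyP[/andP[y1 y2] /negP]]] := H (j0 + a)%N.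
  rewrite negbK => /eqP fy; exists y => _.
  by rewrite -ler_pdivrMr// -ltr_pdivlMr//.
suff : (size [seq y a | a <- iota 0 r] < r)%N by rewrite size_map size_iota ltnn.
apply: uP.
  rewrite map_inj_in_uniq ?iota_uniq// => a b; rewrite !mem_iota !add0n /=.
  move=> /yP[a1 a2 _] /yP[b1 b2 _] ab; rewrite -ab in b1 b2.
  have := le_lt_trans a1 b2; have := le_lt_trans b1 a2.
  by rewrite !ltr_nat !ltnS !leq_add2l => ba ab'; apply/eqP; rewrite eqn_leq ba ab'.
move=> z /mapP[a]; rewrite mem_iota add0n => /= ar ->; have [y1 y2 fy0] := yP a ar.
split; last exact: fy0.
apply/andP; split; last first.
  by rewrite -(ltr_pM2r k0); apply: lt_le_trans y2 (jb a ar).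
rewrite -(ltr_pM2r k0); apply: lt_le_trans ut _; apply: le_trans y1.
by rewrite ler_nat leq_addr.
Qed.

Lemma pow2_bracket (y : R) : 1 <= y -> exists k, y <= 2 ^+ k <= 2 * y.
Proof.
move=> y1; have y0 : 0 <= y by rewrite (le_trans _ y1).
have /andP[ty yt] := truncn_itv y0.
have t0 : (0 < Num.truncn y)%N by rewrite truncn_gt0.
have /andP[Kt tK] := trunc_log_bounds (isT : (1 < 2)%N) t0.
exists (trunc_log 2 (Num.truncn y)).+1; apply/andP; split.
  by rewrite -natrX ltW//; apply: lt_le_trans yt _; rewrite ler_nat.
by rewrite exprS ler_wpM2l//; apply: le_trans ty; rewrite -natrX ler_nat.
Qed.

Lemma powRVn (a : R) : 0 <= a -> (a `^ (r%:R^-1)) ^+ r = a.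
Proof.
move=> a0; rewrite -powR_mulrn ?powR_ge0// -powRrM mulVf ?powRr1//.
by rewrite pnatr_eq0 -lt0n.
Qed.

(** The window has length l = kap |f x|^(1/r), with [kap] ensuring M / r! l^r <= |f x|; 2^k lies
    between (r + 1) / l and twice that. *)
Lemma coordinate_box : exists2 D : R, 1 <= D & forall f x, factor_class r M f ->
  0 <= x <= 1 -> f x != 0 -> exists k j,
  [/\ (j < 2 ^ k)%N, 2 ^+ k <= D * `|f x| `^ (- r%:R^-1) &
    forall y, j%:R / 2 ^+ k <= y < j.+1%:R / 2 ^+ k -> f y != 0].
Proof.
pose kap : R := Num.min 1 ((r`!%:R / M) `^ (r%:R^-1)).
have rM0 : 0 < r`!%:R / M by rewrite divr_gt0// ltr0n fact_gt0.
have kap0 : 0 < kap by rewrite lt_min ltr01 powR_gt0.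
have kap1 : kap <= 1 by rewrite ge_min lexx.
have kapr : M / r`!%:R * kap ^+ r <= 1.
  rewrite mulrC -ler_pdivlMr ?divr_gt0 ?ltr0n ?fact_gt0// div1r invf_div.
  rewrite -(powRVn (ltW rM0)) lerXn2r ?nnegrE ?powR_ge0 ?(ltW kap0)//.
  by rewrite ge_min lexx orbT.
exists (2 * (r.+1%:R / kap)).
  have : 1 <= r.+1%:R / kap :> R.
    by rewrite ler_pdivlMr// mul1r (le_trans kap1)// ler1n.
  lra.
move=> f x ff x01 fx0.
have fx1 : `|f x| <= 1.
  by have [_ H _ _] := ff; have := H x; rewrite !in_itv /= ler_norml => ->.
have a0 : 0 < `|f x| by rewrite normr_gt0.
set a := `|f x| in fx1 a0 *.
pose s := a `^ (r%:R^-1).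
have s0 : 0 < s by rewrite powR_gt0.
have sr : s ^+ r = a by exact: powRVn (ltW a0).
have s1 : s <= 1.
  by rewrite -(@ler_pXn2r _ r) ?nnegrE ?(ltW s0)// sr expr1n.
have [|k /andP[k1 k2]] := @pow2_bracket (r.+1%:R / (kap * s)).
  rewrite ler_pdivlMr ?mulr_gt0// mul1r (@le_trans _ _ 1)//.
    by rewrite mulr_ile1// ltW.
  by rewrite ler1n.
have l01 : 0 < kap * s <= 1 by rewrite mulr_gt0//= mulr_ile1// ltW.
have [||j jk jP] := @dyadic_zero_free f x (kap * s) k ff x01 l01.
- by rewrite exprMn mulrA sr -[leRHS]mul1r ler_wpM2r// ltW.
- by rewrite mulrC -ler_pdivrMr// mulr_gt0.
exists k, j; split=> //; apply: le_trans k2 _.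
by rewrite powRN -/s invfM !mulrA.
Qed.

End Boxes.

(** * Detecting sets *)

Section Detection.
Context {R : realType}.
Variables (r : nat) (M : R).
Hypotheses (r0 : (0 < r)%N) (M0 : 0 < M).

(** What the algorithm needs: if all tests on P fail, |f| is at most e everywhere and the zero
    function is an acceptable output. *)
Definition detects d (e : R) (P : seq (cube R d)) : Prop :=
  forall (fs : 'I_d -> R -> R) x, (forall i, factor_class r M (fs i)) ->
    e < `|tensor fs x| -> exists2 z, z \in P & tensor fs z != 0.

Lemma prod_powR (I : Type) (s : seq I) (a : I -> R) t : (forall i, 0 <= a i) ->
  (\prod_(i <- s) a i) `^ t = \prod_(i <- s) (a i `^ t).
Proof.
move=> a0; suff [_ ] : 0 <= \prod_(i <- s) a i /\
  (\prod_(i <- s) a i) `^ t = \prod_(i <- s) (a i `^ t) by [].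
elim/big_rec2: _ => [|i y z _ [y0 <-]]; first by rewrite powR1.
by rewrite mulr_ge0// powRM.
Qed.

Lemma i01_bounds (x : {i01 R}) : 0 <= x%:num <= 1.
Proof. by rewrite ge0 le1. Qed.

Lemma tensor_factors d (fs : 'I_d -> R -> R) x (e : R) :
  (forall i, factor_class r M (fs i)) -> 0 < e -> e < `|tensor fs x| ->
  [/\ forall i, fs i (x i)%:num != 0, forall i, 0 < `|fs i (x i)%:num| <= 1 &
      e < \prod_i `|fs i (x i)%:num|].
Proof.
move=> ff e0 ex; have nz i : fs i (x i)%:num != 0.
  have : tensor fs x != 0 by rewrite -normr_gt0 (lt_trans e0).
  by move/prodf_neq0; apply.
split=> //; last by rewrite -normr_prod.
move=> i; rewrite normr_gt0 nz /=; have [_ H _ _] := ff i.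
by have := H (x i)%:num; rewrite !in_itv /= ler_norml => ->//; exact: i01_bounds.
Qed.

Lemma powR_anti (a b t : R) : 0 < a -> a <= b -> t <= 0 -> b `^ t <= a `^ t.
Proof.
move=> a0 ab t0; have b0 : 0 < b by exact: lt_le_trans ab.
move: t0; rewrite -oppr_ge0 -[X in _ `^ X]opprK -[X in _ <= _ `^ X]opprK.
move: (- t) => u u0; rewrite !powRN lef_pV2 ?posrE ?powR_gt0//.
by rewrite ge0_ler_powR ?nnegrE// ltW.
Qed.

Lemma powR_ge1 (a t : R) : 0 < a <= 1 -> t <= 0 -> 1 <= a `^ t.
Proof. by move=> /andP[a0 a1] t0; have := powR_anti a0 a1 t0; rewrite powR1. Qed.

Lemma nVr_le0 : - (r%:R^-1 : R) <= 0.
Proof. by rewrite oppr_le0 invr_ge0. Qed.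

(** The product of the zero-free intervals has inverse volume at most B = D^d e^(-1/r), which the
    dyadic net can afford; 192 = 6 * 32 absorbs its constants. *)
Lemma detecting_set_general : exists2 c : R, 1 <= c & forall d (e : R), (0 < d)%N -> 0 < e < 1 ->
  exists2 P : seq (cube R d), (size P)%:R <= c ^+ d * e `^ (- r%:R^-1) & detects e P.
Proof.
have [D D1 DP] := coordinate_box r0 M0.
exists (192 * D); first lra.
move=> d e d0 /andP[e0 e1]; pose B := D ^+ d * e `^ (- r%:R^-1).
have eB : 1 <= e `^ (- r%:R^-1) by apply: powR_ge1 nVr_le0; rewrite e0 ltW.
have B1 : 1 <= B by rewrite -[1]mulr1 ler_pM// exprn_ege1.
have [P [sP HP]] := dyadic_net d0 B1.
exists P.
  apply: le_trans sP _; rewrite /B mulrA exprMn ler_wpM2r ?powR_ge0//.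
  rewrite ler_wpM2r ?exprn_ge0 ?(le_trans ler01 D1)//.
  rewrite (_ : 192 = 6 * 32 :> R); last by rewrite -natrM.
  rewrite exprMn ler_wpM2r ?exprn_ge0//.
  by rewrite -[leLHS]expr1 ler_eXn2l// ltr1n.
move=> fs x ff ex; have [nz a01 ea] := tensor_factors ff e0 ex.
have /choice[k /choice[j kj]] := fun i => DP _ _ (ff i) (i01_bounds (x i)) (nz i).
have kB : \prod_i (2 ^+ k i : R) <= B.
  apply: (@le_trans _ _ (\prod_i (D * `|fs i (x i)%:num| `^ (- r%:R^-1)))).
    by apply: ler_prod => i _; rewrite exprn_ge0//=; case: (kj i).
  rewrite big_split /= prodr_const card_ord ler_wpM2l ?exprn_ge0 ?(le_trans ler01 D1)//.
  rewrite -prod_powR//; apply: powR_anti nVr_le0 => //; exact: ltW.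
have [z zP zb] := HP k j kB (fun i => let: And3 h _ _ := kj i in h).
exists z => //; apply/prodf_neq0 => i _.
by have [_ _] := kj i; apply; exact: zb.
Qed.

End Detection.

(** * The case M < 2^r r! *)

Section SmallM.
Context {R : realType}.
Variables (r : nat) (M : R).
Hypotheses (r0 : (0 < r)%N) (M0 : 0 < M).

(* l > 1/2 matters because every window of length l in [0, 1] then contains ]1 - l, l[. *)
Lemma central_window : M < (2 ^ r * r`!)%N%:R ->
  exists l : R, [/\ 2^-1 < l, l <= 1 & M / r`!%:R * l ^+ r < 1].
Proof.
move=> Mlt; pose b : R := (r`!%:R / M) `^ (r%:R^-1).
have f0 : 0 < r`!%:R :> R by rewrite ltr0n fact_gt0.
have rM0 : 0 < r`!%:R / M by rewrite divr_gt0.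
have br : b ^+ r = r`!%:R / M by exact: (powRVn r0 (ltW rM0)).
have b0 : 0 < b by rewrite powR_gt0.
have b2 : 2^-1 < b.
  rewrite -(@ltr_pXn2r _ r) ?nnegrE ?(ltW b0) ?invr_ge0//.
  rewrite br exprVn ltr_pdivlMr// mulrC ltr_pdivrMr ?exprn_gt0//.
  by move: Mlt; rewrite natrM natrX mulrC.
(* [b] solves M / r! b^r = 1 and exceeds 1/2, so any l strictly between 1/2 and [b] would do; the
   minimum keeps l <= 1. *)
pose l := Num.min 1 ((b + 2^-1) / 2).
have lb : l < b by rewrite gt_min; apply/orP; right; lra.
have l1 : l <= 1 by rewrite ge_min lexx.
have l2 : 2^-1 < l by rewrite lt_min; apply/andP; split; lra.
exists l; split=> //.
have lr : l ^+ r < b ^+ r by rewrite ltr_pXn2r ?nnegrE ?(ltW b0)//; lra.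
have E : M / r`!%:R * b ^+ r = 1 by rewrite br; field; rewrite !gt_eqF.
by rewrite -[X in _ < X]E ltr_pM2l// divr_gt0.
Qed.

Lemma zeros_in_center f x l (z : seq R) : factor_class r M f -> 0 <= x <= 1 ->
  2^-1 < l -> l <= 1 -> M / r`!%:R * l ^+ r <= `|f x| -> uniq z ->
  (forall y, y \in z -> 1 - l < y < l /\ f y = 0) -> (size z < r)%N.
Proof.
move=> ff x01 l2 l1 fx uz zP.
have l01 : 0 < l <= 1 by rewrite l1 andbT; lra.
have [u [u0 ul uP]] := few_zeros_window r0 M0 ff x01 l01 fx.
by apply: uP => // y /zP[yl ->]; split=> //; lra.
Qed.

Definition center_points (l : R) n : seq R :=
  [seq 1 - l + (2 * l - 1) * (a.+1%:R / n.+1%:R) | a <- iota 0 n].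

Lemma center_points_in l n : 2^-1 < l -> l <= 1 ->
  forall t, t \in center_points l n -> 1 - l < t < l.
Proof.
move=> l2 l1 t /mapP[a]; rewrite mem_iota add0n => /= an ->.
have n0 : (0 : R) < n.+1%:R by [].
have q0 : 0 < a.+1%:R / n.+1%:R :> R by rewrite divr_gt0.
have q1 : a.+1%:R / n.+1%:R < 1 :> R by rewrite ltr_pdivrMr// mul1r ltr_nat.
by set q := a.+1%:R / _ in q0 q1 *; nra.
Qed.

Lemma center_points_uniq l n : 2^-1 < l -> uniq (center_points l n).
Proof.
move=> l2; rewrite map_inj_uniq ?iota_uniq// => a b.
have l0 : 2 * l - 1 != 0 by rewrite gt_eqF//; lra.
move=> /addrI /(mulfI l0) /(congr1 ( *%R^~ n.+1%:R)) /=.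
by rewrite !divfK ?pnatr_eq0// => /eqP; rewrite eqr_nat eqSS => /eqP.
Qed.

(* Each coordinate excludes fewer than r of the r * d diagonal parameters. *)
Lemma diagonal_point d (fs : 'I_d -> R -> R) (good : pred 'I_d) (T : seq R) :
  (0 < d)%N -> size T = (r * d)%N ->
  (forall i, good i -> (count (fun t => fs i t == 0%R) T < r)%N) ->
  exists2 t, t \in T & forall i, good i -> fs i t != 0.
Proof.
move=> d0 sT HT; apply/not_exists2P => H.
have : (\sum_(t <- T) 1 <= \sum_(t <- T) \sum_(i < d) (good i && (fs i t == 0%R)))%N.
  rewrite big_seq [leqRHS]big_seq; apply: leq_sum => t tT.
  have [//|/existsNP[i /not_implyP[gi /negP]]] := H t.
  by rewrite negbK => fi; rewrite (bigD1 i)//= gi fi.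
rewrite sum1_size exchange_big /= sT; apply/negP; rewrite -ltnNge.
apply: (@leq_ltn_trans (\sum_(i < d) r.-1)).
  apply: leq_sum => i _; have [gi|_] := boolP (good i); last by rewrite big1.
  rewrite -ltnS prednK//; apply: leq_ltn_trans (HT i gi).
  rewrite -sum1_count [leqRHS]big_mkcond /=.
  by apply: leq_sum => t _; case: (fs i t == 0%R).
by rewrite sum_nat_const card_ord mulnC ltn_pmul2r// prednK.
Qed.

(** All factors are at most 1, so e < a0^N for the number N of small ones. *)
Lemma few_small_factors d (a : 'I_d -> R) (a0 e : R) : 0 < a0 < 1 -> 0 < e ->
  (forall i, 0 < a i <= 1) -> e < \prod_i a i ->
  #|[set i | a i < a0]|%:R <= ln e^-1 / - ln a0.
Proof.
move=> /andP[a00 a01] e0 a1 ea; set bad := [set i | _].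
have la0 : ln a0 < 0 by rewrite ln_lt0// a00.
rewrite ler_pdivlMr ?oppr_gt0// lnV ?posrE// mulrN lerN2.
rewrite mulr_natl -lnXn// ler_ln ?posrE ?exprn_gt0//.
apply: le_trans (ltW ea) _.
rewrite (bigID (mem bad))/= -[leRHS]mulr1 ler_pM//.
- by apply: prodr_ge0 => i _; have /andP[/ltW] := a1 i.
- by apply: prodr_ge0 => i _; have /andP[/ltW] := a1 i.
- rewrite -prodr_const; apply: ler_prod => i; rewrite inE => /ltW ->.
  by have /andP[/ltW ->] := a1 i.
by apply: prodr_ile1 => i _; have /andP[/ltW -> ->] := a1 i.
Qed.

End SmallM.

(** * A net on few coordinates combined with a diagonal *)

Section Mixed.
Context {R : realType}.
Variables (r : nat) (M : R).
Hypotheses (r0 : (0 < r)%N) (M0 : 0 < M).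

(* The coordinates in the range of s come from a net in dimension L, all the
   others are equal to t; when s hits i several times, the choice made by
   [pick] counts. *)
Definition mixed_point d L (s : {ffun 'I_L -> 'I_d}) (t : R) (y : cube R L) : cube R d :=
  [ffun i => if [pick l | s l == i] is Some l then y l else to01 t].

(** [s] is injective on the indices chosen by [pick], and the factors left out are at least 1. *)
Lemma prod_first_le d L (s : {ffun 'I_L -> 'I_d}) (w : 'I_d -> R) :
  (forall i, 1 <= w i) ->
  \prod_(l | [pick l' | s l' == s l] == Some l) w (s l) <= \prod_i w i.
Proof.
move=> w1; set A := [set l | [pick l' | s l' == s l] == Some l].
have inj : {in A &, injective s}.
  move=> l l'; rewrite !inE => /eqP pl /eqP pl' ss.
  by move: pl; rewrite ss pl' => -[].
have -> : \prod_(l | [pick l' | s l' == s l] == Some l) w (s l) = \prod_(l in A) w (s l).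
  by apply: eq_bigl => l; rewrite inE.
rewrite -(big_imset (fun i => w i) inj) /=.
rewrite [leRHS](bigID (mem (s @: A)))/= ler_peMr//.
  by apply: prodr_ge0 => i _; rewrite (le_trans ler01).
elim/big_rec: _ => // i z _ z1.
by rewrite -[1]mulr1 ler_pM.
Qed.

(** At most L coordinates have |f_i x_i| < a0, and [s] lists them. Each coordinate outside the range
    of [s] has fewer than r zeros in ]1 - l, l[, so one of r d values t serves all of these. There
    are d^L maps s. *)
Lemma detects_mixed (l : R) : 2^-1 < l -> l <= 1 -> M / r`!%:R * l ^+ r < 1 ->
  exists2 c : R, 1 <= c & forall d L (e : R), (0 < d)%N -> (0 < L)%N -> 0 < e < 1 ->
  ln e^-1 / - ln (M / r`!%:R * l ^+ r) <= L%:R ->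
  exists2 P : seq (cube R d),
    (size P)%:R <= (d ^ L * (r * d))%N%:R * (c ^+ L * e `^ (- r%:R^-1)) &
    detects r M e P.
Proof.
move=> l2 l1; set a0 := M / r`!%:R * l ^+ r => a01.
have l0 : 0 < l by lra.
have a00 : 0 < a0 by rewrite mulr_gt0 ?exprn_gt0// divr_gt0// ltr0n fact_gt0.
have [D D1 DP] := coordinate_box r0 M0.
exists (192 * D); first lra.
move=> d L e d0 L0 /andP[e0 e1] eL; pose B := D ^+ L * e `^ (- r%:R^-1).
have eB : 1 <= e `^ (- r%:R^-1) by apply: powR_ge1 (nVr_le0 _); rewrite e0 ltW.
have B1 : 1 <= B by rewrite -[1]mulr1 ler_pM// exprn_ege1.
have [Q [sQ HQ]] := dyadic_net L0 B1.
pose T := center_points l (r * d).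
have sT : size T = (r * d)%N by rewrite size_map size_iota.
exists [seq mixed_point st.1 st.2 y |
   st <- [seq (s, t) | s <- enum {ffun 'I_L -> 'I_d}, t <- T], y <- Q].
  rewrite !size_allpairs -cardE card_ffun !card_ord sT natrM ler_wpM2l//.
  apply: le_trans sQ _; rewrite /B mulrA exprMn ler_wpM2r ?powR_ge0//.
  rewrite ler_wpM2r ?exprn_ge0 ?(le_trans ler01 D1)//.
  rewrite (_ : 192 = 6 * 32 :> R); last by rewrite -natrM.
  rewrite exprMn ler_wpM2r ?exprn_ge0//.
  by rewrite -[leLHS]expr1 ler_eXn2l// ltr1n.
move=> fs x ff ex; have [nz a1 ea] := tensor_factors ff e0 ex.
pose a i := `|fs i (x i)%:num|.
have a001 : 0 < a0 < 1 by rewrite a00.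
have bL := few_small_factors a001 e0 a1 ea.
set bad := [set i | _] in bL.
have {}bL : (#|bad| <= L)%N by rewrite -(ler_nat R) (le_trans bL).
(* The list of bad coordinates is padded with coordinate 0, so [s] need not be injective and may hit
   a good coordinate. *)
pose s := [ffun m : 'I_L => nth (Ordinal d0) (enum bad) m].
have sbad i : i \in bad -> exists m, s m = i.
  rewrite -mem_enum => ib; have ilt : (index i (enum bad) < L)%N.
    by apply: leq_trans bL; rewrite cardE index_mem.
  by exists (Ordinal ilt); rewrite ffunE /= nth_index.
have /choice[k /choice[j kj]] := fun i => DP _ _ (ff i) (i01_bounds (x i)) (nz i).
pose fst m := [pick m' | s m' == s m] == Some m.
(* Indices not chosen by [pick] get the trivial interval [0, 1[, which costs nothing. *)
pose k' m := if fst m then k (s m) else 0%N.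
pose j' m := if fst m then j (s m) else 0%N.
have jk' m : (j' m < 2 ^ k' m)%N.
  by rewrite /j' /k'; case: ifP => // _; have [] := kj (s m).
pose w i : R := a i `^ (- r%:R^-1).
have w1 i : 1 <= w i by apply: powR_ge1 (nVr_le0 _); exact: a1.
have kB : \prod_m (2 ^+ k' m : R) <= B.
  apply: (@le_trans _ _ (\prod_m (D * if fst m then w (s m) else 1))).
    apply: ler_prod => m _; rewrite exprn_ge0//= /k'; case: ifP => _.
      by have [] := kj (s m).
    by rewrite expr0 mulr1.
  rewrite big_split /= prodr_const card_ord ler_wpM2l ?exprn_ge0 ?(le_trans ler01 D1)//.
  rewrite -big_mkcond /=; apply: le_trans (prod_first_le s w1) _.
  rewrite -prod_powR => [|i]; last exact: normr_ge0.
  apply: powR_anti (nVr_le0 _) => //; exact: ltW.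
have [y yQ yb] := HQ k' j' kB jk'.
pose good i := i \notin codom s.
have [|t tT tg] := @diagonal_point _ r r0 d fs good T d0 sT.
  move=> i gi; rewrite -size_filter; have ai : a0 <= a i.
    rewrite leNgt; apply: contra gi => ai; have [|m <-] := sbad i; first by rewrite inE.
    exact: codom_f.
  apply: (zeros_in_center r0 M0 (ff i) (i01_bounds (x i)) l2 l1 ai).
    by rewrite filter_uniq// center_points_uniq.
  move=> v; rewrite mem_filter => /andP[/eqP -> vT]; split=> //.
  exact: center_points_in l2 l1 _ vT.
exists (mixed_point s t y).
  apply/allpairsP; exists ((s, t), y); split=> //=.
  by apply/allpairsP; exists (s, t); rewrite mem_enum.
have t01 : 0 <= t <= 1 by have := center_points_in l2 l1 tT; lra.
apply/prodf_neq0 => i _; rewrite ffunE.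
case pE : [pick m | s m == i] => [m|]; last first.
  rewrite to01E// tg// /good; apply/codomP => -[m mi].
  by case: pickP pE => // /(_ m); rewrite mi eqxx.
have smi : s m = i by case: pickP pE => // m' /eqP sm' [<-].
have fm : fst m by rewrite /fst smi pE.
have := yb m; rewrite /j' /k' fm smi.
by have [_ _] := kj i; apply.
Qed.

(** The size is at most r exp(L (ln d + ln c) + ln d + ln(1/e) / r), where L <= (1 + 1/lam) (1 +
    ln(1/e)). The bound c >= 3 leaves room for the cost of recovery. *)
Lemma detecting_set_below_2r_fact : M < (2 ^ r * r`!)%N%:R -> exists2 c : R, 3 <= c &
  forall d (e : R), (0 < d)%N -> 0 < e < 1 ->
  exists2 P : seq (cube R d),
    (size P)%:R <= r%:R * expR (c * (1 + ln e^-1) * (1 + ln d%:R)) & detects r M e P.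
Proof.
move=> Mlt; have [l [l2 l1 a01]] := central_window r0 M0 Mlt.
have [c c1 H] := detects_mixed l2 l1 a01.
set a0 := M / r`!%:R * l ^+ r in a01 H.
have a00 : 0 < a0.
  by rewrite mulr_gt0 ?exprn_gt0 ?divr_gt0// ?ltr0n ?fact_gt0//; lra.
pose lam := - ln a0.
have lam0 : 0 < lam by rewrite oppr_gt0 ln_lt0// a00.
pose c' := (1 + lam^-1) * (1 + ln c) + 3.
have lc0 : 0 <= ln c by rewrite ln_ge0.
have l10 : 0 < 1 + lam^-1 by rewrite addr_gt0 ?invr_gt0.
exists c'; first by rewrite lerDr mulr_ge0 ?(ltW l10)// addr_ge0.
move=> d e d0 /andP[e0 e1].
pose E := ln e^-1; have E0 : 0 <= E by rewrite ln_ge0// -[leLHS]invr1 lef_pV2 ?posrE//; exact: ltW.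
pose ld : R := ln d%:R; have ld0 : 0 <= ld by rewrite ln_ge0// ler1n.
pose L := (Num.truncn (E / lam)).+1.
have El0 : 0 <= E / lam by rewrite divr_ge0// ltW.
have /andP[tL Lt] := truncn_itv El0.
have e01 : 0 < e < 1 by rewrite e0.
have [P sP dP] := H d L e d0 (ltn0Sn _) e01 (ltW Lt).
exists P => //; apply: le_trans sP _.
have dR : 0 < d%:R :> R by rewrite ltr0n.
have cR : 0 < c by rewrite (lt_le_trans ltr01).
have -> : (d ^ L * (r * d))%N%:R * (c ^+ L * e `^ (- r%:R^-1)) =
    r%:R * expR (L%:R * (ld + ln c) + ld + r%:R^-1 * E).
  rewrite !expRD expRM_natl expRD !lnK ?posrE// exprMn !natrM natrX.
  rewrite /powR gt_eqF// /E lnV ?posrE// mulNr mulrN.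
  move: (d%:R ^+ L) (c ^+ L) (expR _) => u v w; ring.
rewrite ler_wpM2l// ler_expR.
have L1 : L%:R <= (1 + lam^-1) * (1 + E) :> R.
  have i0 : 0 <= lam^-1 by rewrite invr_ge0 ltW.
  by rewrite /L -natr1; nra.
apply: (@le_trans _ _ ((1 + lam^-1) * (1 + E) * (ld + ln c) + ld + E)).
  rewrite lerD ?lerD// ?ler_wpM2r ?addr_ge0//.
  by rewrite ler_piMl// invf_le1 ?ltr0n// ler1n.
rewrite /c' -/E -/ld -(mulrA (1 + lam^-1)).
have l1' := ltW l10.
set A := 1 + lam^-1 in l1' *.
apply: (@le_trans _ _ (A * ((1 + ln c) * ((1 + E) * (1 + ld))) + 3 * ((1 + E) * (1 + ld)))).
  rewrite -addrA lerD//; last by nra.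
  rewrite ler_wpM2l//.
  have p0 : 0 <= ln c * ld by rewrite mulr_ge0.
  have p1 : 0 <= E * (ln c * ld) by rewrite mulr_ge0.
  lra.
by rewrite le_eqVlt; apply/orP; left; apply/eqP; ring.
Qed.

End Mixed.

(** * The case M <= r! *)

Section Grid.
Context {R : realType}.
Variables (r : nat) (M : R).
Hypotheses (r0 : (0 < r)%N) (M0 : 0 < M).

Lemma leq_sub_add hi lo m : (hi <= hi - lo.+1 - m + lo + m.+1)%N.
Proof. lia. Qed.

Section Codes.
Variables (d n : nat).

(* An interval of grid indices (lower and upper end) minus at most r points. *)
Definition code : finType := ('I_n.+1 * 'I_n.+1 * {ffun 'I_r -> 'I_n})%type.

Definition code_set (c : code) : {set 'I_n} :=
  [set p : 'I_n | c.1.1 <= p < c.1.2]%N :\: [set c.2 a | a : 'I_r].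

Definition code_box (c : {ffun 'I_d -> code}) : {set {ffun 'I_d -> 'I_n}} :=
  [set p : {ffun 'I_d -> 'I_n} | [forall i, p i \in code_set (c i)]].

Lemma card_code_box (c : {ffun 'I_d -> code}) : #|code_box c| = (\prod_i #|code_set (c i)|)%N.
Proof.
transitivity #|family (fun i => mem (code_set (c i)))|; last first.
  by rewrite card_family foldrE big_map big_enum.
apply: eq_card => p; rewrite inE.
by apply/forallP/familyP.
Qed.

Lemma card_code_set (c : code) : (c.1.2 - c.1.1 - r <= #|code_set c|)%N.
Proof.
rewrite cardsD leq_sub//; last first.
  apply: leq_trans (subset_leq_card (subsetIr _ _)) _.
  by apply: leq_trans (leq_imset_card _ _) _; rewrite card_ord.
have lt a : (a < c.1.2 - c.1.1)%N -> (c.1.1 + a < n)%N.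
  move=> al; apply: (@leq_trans c.1.2); last by rewrite -ltnS ltn_ord.
  by rewrite -ltn_subRL.
pose e (a : 'I_(c.1.2 - c.1.1)) : 'I_n := Ordinal (lt a (ltn_ord a)).
have e_inj : injective e by move=> a a' /(congr1 val)/= /addnI /val_inj.
rewrite -[leqLHS]card_ord -(card_imset predT e_inj) subset_leq_card//.
apply/fintype.subsetP => _ /imsetP[a _ ->].
by rewrite inE /= leq_addr /= -ltn_subRL.
Qed.

(** The logarithm of this number enters the hitting set bound; for fixed r it is of order d ln n. *)
Lemma card_codes : (#|{ffun 'I_d -> code}| <= n.+1 ^ ((r + 2) * d))%N.
Proof.
rewrite card_ffun !card_prod card_ffun !card_ord expnM.
have H : (n.+1 * n.+1 * n ^ r <= n.+1 ^ (r + 2))%N.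
  by rewrite expnD mulnC expnS expn1 leq_mul2r leq_exp2r// leqnSn orbT.
by case: d => // d'; rewrite leq_exp2r.
Qed.

End Codes.

Lemma bernoulli_ineq (t : R) m : 0 <= t <= 1 -> 1 - m%:R * t <= (1 - t) ^+ m.
Proof.
move=> t01; elim: m => [|m IH]; first by rewrite mul0r subr0 expr0.
have m0 : 0 <= m%:R :> R by [].
apply: (@le_trans _ _ ((1 - t) * (1 - m%:R * t))); first by rewrite -natr1; nra.
by rewrite exprS ler_wpM2l//; lra.
Qed.

(** The code describes the grid points strictly inside the window without the zeros among them;
    rounding the ends costs at most 2 points and the removal at most r. *)
Lemma code_of_factor f x l n : factor_class r M f -> 0 <= x <= 1 -> 0 < l <= 1 ->
  M / r`!%:R * l ^+ r <= `|f x| -> (0 < n)%N ->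
  exists c : code n, n%:R * l - r.+2%:R <= #|code_set c|%:R :> R /\
    forall p, p \in code_set c -> f (p%:R / n%:R) != 0.
Proof.
move=> ff x01 l01 fx n0.
have [u [u0 ul uP]] := few_zeros_window r0 M0 ff x01 l01 fx.
have nR : 0 < n%:R :> R by rewrite ltr0n.
have un0 : 0 <= u * n%:R by rewrite mulr_ge0// ltW.
have uln0 : 0 <= (u + l) * n%:R by rewrite mulr_ge0 ?(ltW nR)//; lra.
have /andP[lo1 lo2] := truncn_itv un0.
have /andP[hi1 hi2] := truncn_itv uln0.
have lon : ((Num.truncn (u * n%:R)).+1 < n.+1)%N.
  rewrite ltnS -(ltr_nat R); apply: le_lt_trans lo1 _.
  by rewrite -[ltRHS]mul1r ltr_pM2r//; lra.
have hin : (Num.truncn ((u + l) * n%:R) < n.+1)%N.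
  rewrite ltnS -(ler_nat R); apply: le_trans hi1 _.
  by rewrite -[leRHS]mul1r ler_pM2r//; lra.
pose Z := [seq p : 'I_n <- enum 'I_n | (Num.truncn (u * n%:R) < p < Num.truncn ((u + l) * n%:R))%N
  && (f (p%:R / n%:R) == 0)].
have sZ : (size Z < r)%N.
  rewrite -(size_map (fun p : 'I_n => p%:R / n%:R : R)); apply: uP.
    rewrite map_inj_uniq; first exact: filter_uniq (enum_uniq _).
    move=> p p'.
    move=> /(congr1 ( *%R^~ n%:R)) /=; rewrite !divfK ?gt_eqF// => /eqP.
    by rewrite eqr_nat => /eqP /val_inj.
  move=> y /mapP[p]; rewrite mem_filter => /andP[/andP[/andP[p1 p2] /eqP fp] _] ->.
  split=> //; rewrite ltr_pdivlMr// ltr_pdivrMr//; apply/andP; split.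
    by apply: lt_le_trans lo2 _; rewrite ler_nat.
  by apply: lt_le_trans hi1; rewrite ltr_nat.
(* There are fewer than r zeros; padding with index 0 removes nothing, as the lower end is at least
   1. *)
pose rem : {ffun 'I_r -> 'I_n} := [ffun a : 'I_r => nth (Ordinal n0) Z a].
exists (Ordinal lon, Ordinal hin, rem); split.
  apply: le_trans (_ : _ <= (Num.truncn ((u + l) * n%:R) - (Num.truncn (u * n%:R)).+1 - r)%:R) _;
    last by rewrite ler_nat; apply: (card_code_set (Ordinal lon, Ordinal hin, rem)).
  set hi := Num.truncn _ in hi1 hi2 *; set lo := Num.truncn _ in lo1 lo2 *.
  have : hi%:R <= (hi - lo.+1 - r)%:R + lo%:R + r.+1%:R :> R by rewrite -!natrD ler_nat leq_sub_add.
  by move: hi2; rewrite -!natr1; lra.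
move=> p; rewrite !inE /= => /andP[pr pI]; apply/negP => fp.
have pZ : p \in Z by rewrite mem_filter pI fp mem_enum.
move/negP: pr; apply; apply/imsetP.
have ir : (index p Z < r)%N by apply: ltn_trans sZ; rewrite index_mem.
by exists (Ordinal ir) => //; rewrite ffunE /= nth_index.
Qed.

End Grid.

(** * A hitting set on a fine grid *)

Section Tiny.
Context {R : realType}.
Variables (r : nat) (M : R).
Hypotheses (r0 : (0 < r)%N) (M0 : 0 < M).

(** As M <= r!, windows of length l_i = |f_i x_i|^(1/r) are admissible without a constant, and their
    product is at least 1 / E. Passing to the grid costs a factor 2 at most, hence the density p = 1
    / (2 E). *)
Lemma detects_grid d n (e : R) : M <= r`!%:R -> (0 < d)%N -> 0 < e < 1 ->
  2 * r.+2%:R * d%:R * e `^ (- r%:R^-1) <= n%:R ->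
  exists2 P : seq (cube R d),
    (size P)%:R <= 2 * e `^ (- r%:R^-1) * (((r + 2) * d)%:R * ln n.+1%:R) + 1 & detects r M e P.
Proof.
move=> Mr d0 /andP[e0 e1]; set E := e `^ _ => En.
have E1 : 1 <= E by apply: powR_ge1 (nVr_le0 _); rewrite e0 ltW.
have E0 : 0 < E by exact: lt_le_trans E1.
have dR : 1 <= d%:R :> R by rewrite ler1n.
have n0 : (0 < n)%N.
  rewrite -(ltr0n R); apply: lt_le_trans En; rewrite !mulr_gt0// ltr0n//.
have nR : 0 < n%:R :> R by rewrite ltr0n.
pose p : R := (2 * E)^-1.
have p01 : 0 < p <= 1.
  by rewrite invr_gt0 mulr_gt0//= invf_le1 ?mulr_gt0//; lra.
(* Only codes of sufficient density have to be hit, so the density hypothesis of the greedy bound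
   holds by definition. *)
pose Dset := [set c : {ffun 'I_d -> code r n} |
  p * #|{ffun 'I_d -> 'I_n}|%:R <= #|code_box c|%:R].
have X0 : (0 < #|{ffun 'I_d -> 'I_n}|)%N by rewrite card_ffun !card_ord expn_gt0 n0.
have HS c : c \in Dset -> p * #|{ffun 'I_d -> 'I_n}|%:R <= #|code_box c|%:R.
  by rewrite inE.
have lnn : 0 <= ln n.+1%:R :> R by rewrite ln_ge0// ler1n.
have [G sG GP] : exists2 G : seq {ffun 'I_d -> 'I_n},
    (size G)%:R <= 2 * E * (((r + 2) * d)%:R * ln n.+1%:R) + 1 &
    forall c, c \in Dset -> exists2 g, g \in G & g \in code_box c.
  have [D0|D0] := posnP #|Dset|.
    exists [::]; first by rewrite addr_ge0// mulr_ge0 ?mulr_ge0// ltW.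
    by move=> c; move/eqP: D0; rewrite cards_eq0 => /eqP ->; rewrite inE.
  have [G sG GP] := hitting_set p01 X0 HS D0.
  exists G => //; apply: le_trans sG _; rewrite lerD2r /p invrK mulrC.
  rewrite ler_wpM2l ?mulr_ge0 ?(ltW E0)//.
  rewrite mulr_natl -lnXn// ler_ln ?posrE ?ltr0n ?exprn_gt0// -natrX ler_nat.
  by apply: leq_trans (max_card _) (card_codes _ _ _).
pose pt (g : {ffun 'I_d -> 'I_n}) : cube R d := [ffun i => to01 ((g i)%:R / n%:R)].
exists (map pt G); first by rewrite size_map.
move=> fs x ff ex; have [nz a1 ea] := tensor_factors ff e0 ex.
pose a i : R := `|fs i (x i)%:num|.
pose l i : R := a i `^ (r%:R^-1).
have a0 i : 0 < a i by have /andP[] := a1 i.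
have l0 i : 0 < l i by rewrite powR_gt0.
have lr i : l i ^+ r = a i by rewrite /l; apply: (powRVn r0); exact: ltW.
have l1 i : l i <= 1.
  rewrite -(@ler_pXn2r _ r) ?nnegrE ?(ltW (l0 i))// lr expr1n.
  by have /andP[] := a1 i.
have l01 i : 0 < l i <= 1 by rewrite l0 l1.
have fl i : M / r`!%:R * l i ^+ r <= `|fs i (x i)%:num|.
  rewrite lr -[leRHS]mul1r ler_wpM2r ?(ltW (a0 i))//.
  by rewrite ler_pdivrMr ?mul1r// ltr0n fact_gt0.
have prodl : E^-1 <= \prod_i l i.
  rewrite -prod_powR => [|i]; last exact: ltW.
  rewrite /E powRN invrK ge0_ler_powR ?nnegrE ?invr_ge0//; try exact: ltW.
  by apply: le_trans (ltW e0) (ltW ea).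
have lE i : E^-1 <= l i.
  apply: le_trans prodl _; rewrite (bigD1 i)//= ler_piMr ?(ltW (l0 i))//.
  by apply: prodr_ile1 => m _; rewrite (ltW (l0 m)) l1.
have /choice[c cP] := fun i => code_of_factor r0 M0 (ff i) (i01_bounds (x i)) (l01 i) (fl i) n0.
(* Since n l_i >= n / E >= 2 (r + 2) d, the loss of r + 2 points is at most a fraction t of n l_i,
   and (1 - t)^d >= 1 - d t = 1/2 by Bernoulli. *)
pose t : R := (2 * d%:R)^-1.
have t0 : 0 < t by rewrite invr_gt0 mulr_gt0//; lra.
have t1 : t <= 1 by rewrite invf_le1 ?mulr_gt0//; lra.
have big i : n%:R * l i * (1 - t) <= #|code_set (c i)|%:R.
  have [ci _] := cP i; apply: le_trans ci.
  rewrite mulrBr mulr1 lerD2l lerN2 /t.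
  rewrite ler_pdivlMr ?mulr_gt0//; last lra.
  have H : n%:R * E^-1 <= n%:R * l i by rewrite ler_wpM2l// ltW.
  apply: le_trans H; rewrite ler_pdivlMr//; lra.
have cD : [ffun i => c i] \in Dset.
  rewrite inE card_code_box natr_prod card_ffun !card_ord natrX.
  apply: (@le_trans _ _ (\prod_(i < d) (n%:R * l i * (1 - t)))); last first.
    apply: ler_prod => i _; rewrite ffunE big andbT.
    by rewrite !mulr_ge0 ?(ltW nR) ?(ltW (l0 i))// subr_ge0.
  rewrite !big_split /= !prodr_const !card_ord mulrC -mulrA ler_wpM2l ?exprn_ge0 ?(ltW nR)//.
  rewrite /p invfM mulrC ler_pM ?invr_ge0 ?(ltW E0)//.
  have t01 : 0 <= t <= 1 by rewrite t1 ltW.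
  apply: le_trans (bernoulli_ineq d t01); rewrite /t invfM mulrCA mulfV ?gt_eqF//; lra.
have [g gG] := GP _ cD; rewrite inE => /forallP gc.
exists (pt g); first by apply/mapP; exists g.
apply/prodf_neq0 => i _; have [_ H] := cP i.
rewrite ffunE to01E; last first.
  by rewrite divr_ge0//= ler_pdivrMr// mul1r ler_nat ltnW.
by apply: H; have := gc i; rewrite ffunE.
Qed.

(** With n the integer part of N plus 1, n + 1 <= 2 N = q d E, so ln(n + 1) is at most (ln q + 2) d
    max(1, ln E); this yields the second factor d. *)
Lemma detecting_set_below_fact : M <= r`!%:R -> exists2 c : R, 1 <= c &
  forall d (e : R), (0 < d)%N -> 0 < e < 1 ->
  exists2 P : seq (cube R d),
    (size P)%:R <= c * d%:R ^+ 2 * e `^ (- r%:R^-1) *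
      Num.max 1 (ln (e `^ (- r%:R^-1))) & detects r M e P.
Proof.
move=> Mr; pose q : R := 4 * r.+2%:R.
have q1 : 1 <= q by rewrite /q -natrM ler1n.
have lq : 0 <= ln q by rewrite ln_ge0.
pose c : R := 2 * (r + 2)%:R * (ln q + 2) + 1.
exists c; first by rewrite lerDr !mulr_ge0// addr_ge0.
move=> d e d0 e01; have /andP[e0 e1] := e01; set E := e `^ _.
have E1 : 1 <= E by apply: powR_ge1 (nVr_le0 _); rewrite e0 ltW.
have E0 : 0 < E by exact: lt_le_trans E1.
have dR : 1 <= d%:R :> R by rewrite ler1n.
have rd : 1 <= r.+2%:R :> R by rewrite ler1n.
pose N : R := 2 * r.+2%:R * d%:R * E.
have dE1 : 1 <= d%:R * E by rewrite -[leLHS]mulr1 ler_pM.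
have N2 : 2 <= N.
  rewrite /N -2!mulrA -[leLHS]mulr1 ler_wpM2l// -[leLHS]mulr1 ler_pM//.
have N0 : 0 <= N by lra.
have /andP[tN Nt] := truncn_itv N0.
have [P sP dP] := detects_grid Mr d0 e01 (ltW Nt).
exists P => //; apply: le_trans sP _; rewrite -/E.
set n := (Num.truncn N).+1.
set mx := Num.max 1 (ln E).
have mx1 : 1 <= mx by rewrite le_max lexx.
have mxE : ln E <= mx by rewrite le_max lexx orbT.
have lnn : ln n.+1%:R <= ln q + ln d%:R + ln E.
  rewrite -!lnM ?posrE ?mulr_gt0//; try lra.
  rewrite ler_ln ?posrE ?ltr0n ?mulr_gt0//; try lra.
  by rewrite /n -!natr1 /q; move: tN N2; rewrite /N; lra.
have lnd : ln d%:R <= d%:R :> R.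
  have H0 : ln (1 + (d%:R - 1)) <= d%:R - 1 :> R by apply: le_ln1Dx; lra.
  by rewrite addrCA subrr addr0 in H0; lra.
have H : ln n.+1%:R <= (ln q + 2) * (d%:R * mx).
  have p1 : 1 <= d%:R * mx by rewrite -[leLHS]mulr1 ler_pM.
  have p2 : d%:R <= d%:R * mx by rewrite ler_peMr//; lra.
  have p3 : mx <= d%:R * mx by rewrite ler_peMl//; lra.
  have p4 : ln q <= ln q * (d%:R * mx) by rewrite ler_peMr.
  lra.
apply: (@le_trans _ _ (2 * E * ((r + 2)%:R * d%:R * ((ln q + 2) * (d%:R * mx))) + d%:R ^+ 2 * E * mx)).
  apply: lerD; last by rewrite -[leLHS]mulr1 ler_pM// -[leLHS]mulr1 ler_pM// exprn_ege1.
  rewrite ler_wpM2l ?mulr_ge0 ?(ltW E0)// natrM ler_wpM2l// mulr_ge0//.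
by rewrite le_eqVlt; apply/orP; left; apply/eqP; rewrite /c; ring.
Qed.

End Tiny.

(** * The algorithm *)

Local Open Scope classical_set_scope.
Local Open Scope ring_scope.

Section Algorithm.
Context {R : realType} {d : nat}.
Implicit Types (I : cube R d -> algorithm R d) (f : cube R d -> R).

Variant detect_spec I f (s : seq (cube R d)) : (cube R d -> R) -> nat -> Prop :=
| DetectSome z n of z \in s & f z != 0 & (n < size s)%N :
    detect_spec I f s (run (I z) f) (n.+1 + cost (I z) f)
| DetectNone of (forall z, z \in s -> f z = 0) : detect_spec I f s (fun=> 0) (size s).

Lemma detectP I f s : detect_spec I f s (run (detect_then I s) f) (cost (detect_then I s) f).
Proof.
elim: s => [|z s IH] /=; first by apply: DetectNone.
have [fz|fz] := eqVneq (f z) 0; last first.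
  by apply: (@DetectSome I f (z :: s) z 0) => //; rewrite mem_head.
case: IH => [y n ys fy ns|fs].
  by rewrite -addSn; apply: DetectSome => //; rewrite inE ys orbT.
by apply: DetectNone => y; rewrite inE => /orP[/eqP->//|/fs].
Qed.

(** If a test succeeds, the recovery method is accurate; otherwise f vanishes on P, and detection
    forces |f| <= e. *)
Lemma algorithm_bounds r (M e : R) (J : nat -> cube R d -> algorithm R d)
    (P : seq (cube R d)) m : 0 < e -> detects r M e P ->
  (forall z f, rank_one_class d r M f -> (cost (J m z) f <= m)%N) ->
  (forall z f, rank_one_class d r M f -> f z != 0 ->
     (sup_norm (run (J m z) f \- f)%R <= e%:E)%E) ->
  let A := A_alg J (seq_fset tt P) m in
  (worst_error (rank_one_class d r M) A <= e%:E)%E /\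
  (worst_cost (rank_one_class d r M) A <= (size P + m)%:R%:E)%E.
Proof.
move=> e0 dP Jc Je /=; rewrite /A_alg; set s := enum_fset _.
have ss : (size s <= size P)%N by rewrite (size_seq_fset tt P : size s = _) size_undup.
have sP z : z \in P -> z \in s by rewrite -(seq_fsetE tt).
split; apply: ge_ereal_sup => _ [f Ff <-].
  case: detectP => [z n _ fz _|f0].
    apply: le_trans (Je z f Ff fz); apply: ge_ereal_sup => _ [x _ <-].
    by apply: ereal_sup_ubound; exists x => //=; rewrite distrC.
  apply: ge_ereal_sup => _ [x _ <-]; rewrite lee_fin /= subr0.
  case: Ff f0 => fs ff -> f0; rewrite leNgt; apply/negP => ex.
  by have [z /sP/f0 ->] := dP fs x ff ex; rewrite eqxx.
rewrite lee_fin ler_nat; case: detectP => [z n _ _ ns|_].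
  by rewrite leq_add// ?Jc// (leq_trans ns).
by rewrite (leq_trans ss)// leq_addr.
Qed.

End Algorithm.

(** * One point set and one number m for all three cost bounds *)

Theorem theorem1 (R : realType) (r : nat) (M : R) (hr : (0 < r)%N) (hM : 0 < M)
    (C : R) (hC : 0 < C) (I : forall d, nat -> cube R d -> algorithm R d)
    (hI : recovery_from_nonzero r M C I) :
  exists c1 c2 c3 c4 : R, [/\ 0 < c1, 0 < c2, 0 < c3 & 0 < c4] /\
    forall (d : nat) (e : R), (0 < d)%N -> 0 < e < 1 ->
      exists (P : {fset cube R d}) (m : nat),
        let F := rank_one_class d r M in
        let A := A_alg (I d) P m in
        [/\ (0 < m)%N,
            (worst_error F A <= e%:E)%E,
            (worst_cost F A <= (c1 ^+ d * e `^ (- r%:R^-1))%:E)%E,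
            M < (2 ^ r * r`!)%N%:R ->
              (worst_cost F A <=
                (c2 * expR (c3 * (1 + ln e^-1) * (1 + ln d%:R)))%:E)%E
          & M <= r`!%:R ->
              (worst_cost F A <=
                (c4 * d%:R ^+ 2 * e `^ (- r%:R^-1) *
                 Num.max 1 (ln (e `^ (- r%:R^-1))))%:E)%E].
Proof.
have [hcost herr] := hI.
have [ca ca1 Ha] := detecting_set_general hr hM.
(* The constants must exist whatever the size of M, so the condition on M moves inside; where it
   fails, 3 is an arbitrary admissible value. *)
have [cs cs3 Hs] : exists2 c : R, 3 <= c & M < (2 ^ r * r`!)%N%:R ->
    forall d (e : R), (0 < d)%N -> 0 < e < 1 -> exists2 P : seq (cube R d),
    (size P)%:R <= r%:R * expR (c * (1 + ln e^-1) * (1 + ln d%:R)) & detects r M e P.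
  have [Mlt|] := boolP (M < (2 ^ r * r`!)%N%:R); last by exists 3.
  by have [c c3 H] := detecting_set_below_2r_fact hr hM Mlt; exists c.
have [ct ct1 Ht] : exists2 c : R, 1 <= c & M <= r`!%:R ->
    forall d (e : R), (0 < d)%N -> 0 < e < 1 -> exists2 P : seq (cube R d),
    (size P)%:R <= c * d%:R ^+ 2 * e `^ (- r%:R^-1) *
      Num.max 1 (ln (e `^ (- r%:R^-1))) & detects r M e P.
  have [Mle|] := boolP (M <= r`!%:R); last by exists 1.
  by have [c c1 H] := detecting_set_below_fact hr hM Mle; exists c.
exists (2 * (ca + 4 * (C + 1))), (r%:R + C + 1), cs, (ct + C + 1).
split; first by have r0 : 0 <= r%:R :> R by []; split; lra.
move=> d e d0 e01; have /andP[e0 e1] := e01.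
set E := e `^ _; set Z := expR _; set mx := Num.max 1 _.
have E1 : 1 <= E by apply: powR_ge1 (nVr_le0 _); rewrite e0 ltW.
have E0 : 0 <= E by lra.
have dR : 1 <= d%:R :> R by rewrite ler1n.
have mx1 : 1 <= mx by rewrite le_max lexx.
(* All bounds must hold for the same P: the shortest available detecting set inherits every size
   bound. *)
have shorter (P Q : seq (cube R d)) : detects r M e P -> detects r M e Q ->
    exists T : seq (cube R d), [/\ detects r M e T, (size T <= size P)%N & (size T <= size Q)%N].
  by move=> dP dQ; have [PQ|QP] := leqP (size P) (size Q); [exists P|exists Q; split=> //; exact: ltnW].
have [P [dP Pa Ps Pt]] : exists P : seq (cube R d), [/\ detects r M e P, (size P)%:R <= ca ^+ d * E,
    M < (2 ^ r * r`!)%N%:R -> (size P)%:R <= r%:R * Z &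
    M <= r`!%:R -> (size P)%:R <= ct * d%:R ^+ 2 * E * mx].
  have [P1 P1a dP1] := Ha d e d0 e01.
  have [P2 [dP2 P2a P2s]] : exists P : seq (cube R d), [/\ detects r M e P, (size P)%:R <= ca ^+ d * E &
      M < (2 ^ r * r`!)%N%:R -> (size P)%:R <= r%:R * Z].
    have [Mlt|] := boolP (M < (2 ^ r * r`!)%N%:R); last by exists P1.
    have [Q Qs dQ] := Hs Mlt d e d0 e01; have [T [dT TP TQ]] := shorter _ _ dP1 dQ.
    exists T; split=> // [|_]; first by apply: le_trans P1a; rewrite ler_nat.
    by apply: le_trans Qs; rewrite ler_nat.
  have [Mle|] := boolP (M <= r`!%:R); last by exists P2.
  have [Q Qt dQ] := Ht Mle d e d0 e01; have [T [dT TP TQ]] := shorter _ _ dP2 dQ.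
  exists T; split=> // [|Mlt|_]; first by apply: le_trans P2a; rewrite ler_nat.
    by apply: le_trans (P2s Mlt); rewrite ler_nat.
  by apply: le_trans Qt; rewrite ler_nat.
(* The number m prescribed for e may be 0; it is positive for e' <= e. *)
have [m [m0 mb mJ]] : exists m, [/\ (0 < m)%N, m%:R <= (C + 1) * d%:R ^+ 2 * E &
    forall z f, rank_one_class d r M f -> f z != 0 ->
      (sup_norm (run (I d m z) f \- f)%R <= e%:E)%E].
  pose w : R := C * d%:R `^ (1 + r%:R^-1).
  have w0 : 0 < w by rewrite mulr_gt0// powR_gt0; lra.
  have rV : r%:R^-1 <= 1 :> R by rewrite invf_le1 ?ltr0n// ler1n.
  have wd : w <= C * d%:R ^+ 2.
    rewrite ler_wpM2l ?(ltW hC)// -(powR_mulrn 2); last lra.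
    by rewrite ler_powR// lerD2l.
  (* For accuracy w^r the quantity to be rounded down is exactly 1, so the minimum guarantees m >=
     1. *)
  pose e' := Num.min e (w ^+ r).
  have wr0 : 0 < w ^+ r by rewrite exprn_gt0.
  have e'0 : 0 < e' by rewrite lt_min e0.
  have e'e : e' <= e by rewrite ge_min lexx.
  have e'01 : 0 < e' < 1 by rewrite e'0 (le_lt_trans e'e).
  have wE : (w ^+ r) `^ (- r%:R^-1) = w^-1.
    rewrite -(powR_mulrn r (ltW w0)) -powRrM mulrN mulfV ?pnatr_eq0 -?lt0n//.
    by rewrite powR_inv1 ?(ltW w0).
  have E'1 : 1 <= w * e' `^ (- r%:R^-1).
    rewrite mulrC -ler_pdivrMr// div1r -wE powR_anti ?nVr_le0//.
    by rewrite ge_min lexx orbT.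
  exists (Num.truncn (w * e' `^ (- r%:R^-1))); split.
  - by rewrite truncn_gt0.
  - have /andP[tm _] := truncn_itv (le_trans ler01 E'1); apply: le_trans tm _.
    have dE : 1 <= d%:R ^+ 2 * E by rewrite -[leLHS]mulr1 ler_pM// exprn_ege1.
    have wdE : w * E <= C * (d%:R ^+ 2 * E) by rewrite mulrA ler_wpM2r.
    rewrite -mulrA.
    rewrite /e'; have [_|_] := leP e (w ^+ r).
      by rewrite -/E; move: dE wdE; set u := d%:R ^+ 2 * E; lra.
    rewrite wE mulfV ?gt_eqF//.
    have : 0 <= C * (d%:R ^+ 2 * E) by rewrite mulr_ge0 ?(ltW hC)//; lra.
    by move: dE; set u := d%:R ^+ 2 * E; lra.
  - move=> z f Ff fz; apply: le_trans (herr d e' d0 e'01 z f Ff fz) _.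
    by rewrite lee_fin.
have [err cst] := algorithm_bounds e0 dP (fun z f => hcost d m z f d0) mJ.
exists (seq_fset tt P), m; split=> // [|Mlt|Mle];
  apply: le_trans cst _; rewrite lee_fin natrD.
- set X := ca + 4 * (C + 1).
  have X0 : 0 <= X by rewrite /X; lra.
  have caX : ca ^+ d <= X ^+ d by rewrite lerXn2r ?nnegrE// /X; lra.
  (* d <= 2^d gives d^2 <= 4^d, and C + 1 <= (C + 1)^d; hence the summand 4 (C + 1) in [X]. *)
  have dX : (C + 1) * d%:R ^+ 2 <= X ^+ d.
    apply: (@le_trans _ _ ((4 * (C + 1)) ^+ d)); last by rewrite lerXn2r ?nnegrE /X//; lra.
    rewrite exprMn mulrC ler_pM//; try lra.
    + have -> : 4 ^+ d = (2 ^+ d) ^+ 2 :> R by rewrite -exprM mulnC exprM; congr (_ ^+ _); ring.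
      by rewrite lerXn2r ?nnegrE// -natrX ler_nat ltnW// ltn_expl.
    + by rewrite -[leLHS]expr1 ler_weXn2l//; lra.
  apply: (@le_trans _ _ (2 * X ^+ d * E)).
    apply: (@le_trans _ _ (ca ^+ d * E + (C + 1) * d%:R ^+ 2 * E)); first exact: lerD.
    by rewrite -mulrDl ler_wpM2r//; lra.
  by rewrite exprMn ler_wpM2r// ler_wpM2r ?exprn_ge0// -[leLHS]expr1 ler_weXn2l// ler1n.
- apply: (@le_trans _ _ (r%:R * Z + (C + 1) * Z)); last by rewrite -mulrDl addrA.
  rewrite lerD ?Ps//; apply: le_trans mb _; rewrite -mulrA ler_wpM2l//; first lra.
  have dpos : 0 < d%:R :> R by lra.
  (* The exponent is at most 3 (1 + ln(1/e)) (1 + ln d), which is why [cs] is at least 3. *)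
  have -> : d%:R ^+ 2 * E = expR (2 * ln d%:R + r%:R^-1 * ln e^-1).
    rewrite expRD expRM_natl lnK ?posrE// /E /powR gt_eqF// lnV ?posrE//.
    by rewrite mulrN mulNr.
  rewrite ler_expR.
  have ld0 : 0 <= ln d%:R :> R by rewrite ln_ge0.
  have le0 : 0 <= ln e^-1 by rewrite ln_ge0// -[leLHS]invr1 lef_pV2 ?posrE//; exact: ltW.
  have rle : r%:R^-1 * ln e^-1 <= ln e^-1.
    by rewrite ler_piMl// invf_le1 ?ltr0n// ler1n.
  apply: (@le_trans _ _ (3 * ((1 + ln e^-1) * (1 + ln d%:R)))); first by nra.
  by rewrite -mulrA ler_wpM2r// mulr_ge0//; lra.
- have B0 : 0 <= d%:R ^+ 2 * E by rewrite mulr_ge0// exprn_ge0.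
  apply: (@le_trans _ _ (ct * d%:R ^+ 2 * E * mx + (C + 1) * d%:R ^+ 2 * E * mx)).
    rewrite lerD ?Pt//; apply: le_trans mb _; rewrite ler_peMr// -mulrA mulr_ge0//; lra.
  by rewrite -!mulrDl addrA.
Qed.
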